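(* There exists a universal constant $\alpha>0$ such that the following holds. Let $G=(V,E)$ be a regular graph on $n$ vertices whose normalized adjacency matrix has second largest singular value $\sigma_2(G)\le\alpha$. Let $c\ge0$ be a fixed constant and $\pi:V\to V$ a permutation. Then there is a $\mathrm{poly}(|E|)$-time algorithm that constructs a collection $\mathcal{P}$ of paths in $G$ of length $O(\log n)$, containing a path from $u$ to $\pi(u)$ for all but an $O(1/\log^c n)$ fraction of vertices $u$, such that every vertex of $V$ is used in at most $O(\log^{c+1}n)$ paths of $\mathcal{P}$. *)

(* Defs.v *)
From mathcomp Require Import all_boot all_order all_algebra all_fingroup.
From mathcomp Require Import polyrcf.
From mathcomp Require Import all_classical all_reals exp.

Set Implicit Arguments.
Unset Strict Implicit.
Unset Printing Implicit Defensive.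

Import Order.TTheory GRing.Theory Num.Theory.

Local Open Scope ring_scope.

(* Finite simple graphs. The vertex set is 'I_n so that graphs can be given to
   an algorithm as input. *)
Record sgraph (n : nat) := SGraph {
  adj :> rel 'I_n;
  adj_sym : symmetric adj;
  adj_irrefl : irreflexive adj }.

Definition edges n (G : sgraph n) : {set {set 'I_n}} :=
  [set [set uv.1; uv.2] | uv : 'I_n * 'I_n & G uv.1 uv.2].

Definition regular n (G : sgraph n) (d : nat) : Prop :=
  forall u : 'I_n, #|[set v | G u v]| = d.

Definition normalized_adjacency (R : realType) n (G : sgraph n) (d : nat) :
    'M[R]_n :=
  \matrix_(u, v) ((G u v)%:R / d%:R).

(* Square roots of the eigenvalues of A^T A, each repeated according to its
   multiplicity as a root of the characteristic polynomial, in non-increasing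
   order. *)
Definition singular_values (R : realType) n (A : 'M[R]_n) : seq R :=
  let p := char_poly (A^T *m A) in
  sort >=%R (flatten [seq nseq (mup x p) (Num.sqrt x) | x <- rootsR p]).

Definition sigma2 (R : realType) n (A : 'M[R]_n) : R :=
  nth 0 (singular_values A) 1.

(* A path is the nonempty sequence of its (distinct) vertices. *)
Definition is_path n (G : sgraph n) (p : seq 'I_n) : bool :=
  if p is x :: q then path G x q && uniq p else false.

Definition path_length n (p : seq 'I_n) : nat := (size p).-1.

Definition joins n (p : seq 'I_n) (u v : 'I_n) : bool :=
  (ohead p == Some u) && (ohead (rev p) == Some v).

Definition unrouted n (pi : {perm 'I_n}) (P : seq (seq 'I_n)) : {set 'I_n} :=
  [set u | ~~ has (fun p => joins p u (pi u)) P].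

Definition load n (P : seq (seq 'I_n)) (v : 'I_n) : nat :=
  count (fun p => v \in p) P.

(* Deterministic random-access machines, as structured programs. A machine has
   registers and finitely many arrays (those its program mentions) indexed by
   and holding natural numbers. Every instruction and every test costs one
   step. Addition and truncated subtraction are the only arithmetic operations:
   a number computed in t steps has at most t + O(log N) bits, where N bounds
   the input values and the constants of the program, hence polynomial time here
   is polynomial time on Turing machines. With multiplication at unit cost this
   would fail. *)
Inductive prog :=
| Const of nat & nat            (* r_x := k             *)
| Add of nat & nat & nat        (* r_x := r_y + r_z     *)
| Sub of nat & nat & nat        (* r_x := r_y - r_z     *)
| Read of nat & nat & nat       (* r_x := a[r_y]        *)
| Write of nat & nat & nat      (* a[r_x] := r_y        *)
| Seq of prog & prog
| If of nat & prog & prog       (* tests r_x <> 0       *)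
| While of nat & prog.          (* loops while r_x <> 0 *)

Record memory := Memory { reg : nat -> nat; arr : nat -> nat -> nat }.

Definition update (T : Type) (f : nat -> T) (x : nat) (v : T) : nat -> T :=
  fun y => if y == x then v else f y.

Definition set_reg (s : memory) (x v : nat) : memory :=
  Memory (update (reg s) x v) (arr s).

Definition set_arr (s : memory) (a i v : nat) : memory :=
  Memory (reg s) (update (arr s) a (update (arr s a) i v)).

(* runs c s t s' : started in s, the program c halts in s' after t steps. *)
Inductive runs : prog -> memory -> nat -> memory -> Prop :=
| RunConst s x k : runs (Const x k) s 1 (set_reg s x k)
| RunAdd s x y z : runs (Add x y z) s 1 (set_reg s x (reg s y + reg s z)%N)
| RunSub s x y z : runs (Sub x y z) s 1 (set_reg s x (reg s y - reg s z)%N)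
| RunRead s x a y : runs (Read x a y) s 1 (set_reg s x (arr s a (reg s y)))
| RunWrite s a x y : runs (Write a x y) s 1 (set_arr s a (reg s x) (reg s y))
| RunSeq c1 c2 s1 s2 s3 t1 t2 :
    runs c1 s1 t1 s2 -> runs c2 s2 t2 s3 ->
    runs (Seq c1 c2) s1 (t1 + t2)%N s3
| RunIfTrue x c1 c2 s t s' :
    reg s x != 0%N -> runs c1 s t s' -> runs (If x c1 c2) s t.+1 s'
| RunIfFalse x c1 c2 s t s' :
    reg s x = 0%N -> runs c2 s t s' -> runs (If x c1 c2) s t.+1 s'
| RunWhileTrue x c s1 s2 s3 t1 t2 :
    reg s1 x != 0%N -> runs c s1 t1 s2 -> runs (While x c) s2 t2 s3 ->
    runs (While x c) s1 (t1 + t2).+1 s3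
| RunWhileFalse x c s : reg s x = 0%N -> runs (While x c) s 1 s.

Definition holds_seq (a : nat -> nat) (w : seq nat) : Prop :=
  forall i, (i < size w)%N -> a i = nth 0%N w i.

Definition memory_of_seq (w : seq nat) : nat -> nat := nth 0%N w.

(* Input: n in register 0, the adjacency matrix of G, row by row, in array 0 and
   the table of pi in array 1; everything else is 0. *)
Definition input n (G : sgraph n) (pi : {perm 'I_n}) : memory :=
  Memory
    (update (fun=> 0%N) 0 n)
    (update
      (update (fun=> fun=> 0%N)
        0 (memory_of_seq [seq nat_of_bool (G u v) | u <- enum 'I_n,
                                                     v <- enum 'I_n]))
        1 (memory_of_seq [seq nat_of_ord (pi u) | u <- enum 'I_n])).

(* Output: in array 2, the number of paths, followed by the paths, each preceded
   by its number of vertices. *)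
Definition encode_paths n (P : seq (seq 'I_n)) : seq nat :=
  size P :: flatten [seq size p :: [seq nat_of_ord v | v <- p] | p <- P].

Definition outputs n (s : memory) (P : seq (seq 'I_n)) : Prop :=
  holds_seq (arr s 2) (encode_paths P).

(* Main.v *)
(** Let the machine route greedily: scan the vertices in phases; for every
    unrouted [u], search breadth-first from [pi u] among the vertices whose load
    is still below a threshold, up to distance [L = O(log n)], and add the path
    found, if any. The threshold grows by [K = 36 (L + 1)] per phase.

    If [k] vertices are unrouted when a phase starts, the paths of that phase have
    total size at most [k (L + 1)], so the set [S] of vertices that reach the
    threshold satisfies [36 |S| <= k]. Tanner's inequality gives a graph with
    [sigma2 <= 1/4] vertex expansion, hence deleting [S] and at most [6 |S|] further
    vertices leaves a graph of diameter at most [L]. Therefore at most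
    [14 |S| <= k / 2] vertices remain unrouted.

    After [J] phases a fraction [2^-J] is unrouted and the loads are [J K]. An
    exponent [c > 0] may be an uncomputable real, so the machine cannot aim at a load
    of order [log^(c+1) n]; instead it runs [J = m log log n] phases for an integer
    [m >= c], which leaves a fraction at most [1/log^c n] with loads
    [O(log n log log n)], within the bound because [c > 0]. For [c = 0] the empty
    collection of paths will do. *)
Require Import Defs.
From mathcomp Require Import all_boot all_order all_algebra all_fingroup.
From mathcomp Require Import polyrcf complex spectral sesquilinear.
From mathcomp Require Import all_reals exp.
From mathcomp Require Import ring lra zify.

Set Implicit Arguments.
Unset Strict Implicit.
Unset Printing Implicit Defensive.

(* [Defs] is imported again because [eqtype] hides the constructor [Sub]. *)
Import Order.TTheory GRing.Theory Num.Theory Defs.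

(** * Singular values and vertex expansion *)

Local Open Scope ring_scope.

Lemma char_poly_similar (F : fieldType) n (P A : 'M[F]_n) :
  P \in unitmx -> char_poly (invmx P *m A *m P) = char_poly A.
Proof.
move=> Pu; rewrite /char_poly /char_poly_mx.
have -> : 'X%:M - map_mx polyC (invmx P *m A *m P) =
   map_mx polyC (invmx P) *m ('X%:M - map_mx polyC A) *m map_mx polyC P.
  rewrite mulmxBr mulmxBl !map_mxM /=; congr (_ - _).
  rewrite scalar_mxC -mulmxA -map_mxM mulVmx //.
  by rewrite map_mx1 mulmx1.
rewrite !det_mulmx mulrAC -det_mulmx -map_mxM mulVmx //.
by rewrite map_mx1 det1 mul1r.
Qed.

Lemma count_flatten_nseq (T : eqType) (m : T -> nat) (s : seq T) (x : T) :
  uniq s ->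
  count_mem x (flatten [seq nseq (m y) y | y <- s]) = (m x * (x \in s))%N.
Proof.
elim: s => [|y s IH] //=; first by rewrite muln0.
case/andP=> ys us; rewrite count_cat count_nseq IH // inE /=.
case: eqVneq ys => [->|ne] ys /=.
  by rewrite (negbTE ys) muln0 addn0 mulnC.
by rewrite mul0n.
Qed.

(** For a product of linear factors, the multiplicity of a root is its number of occurrences in [r],
    so the definition by roots and multiplicities becomes a plain list of eigenvalues, up to
    order. *)
Lemma singular_values_split (R : realType) n (A : 'M[R]_n) (r : seq R) :
  char_poly (A^T *m A) = \prod_(y <- r) ('X - y%:P) ->
  perm_eq (singular_values A) [seq Num.sqrt y | y <- r].
Proof.
move=> Hp; rewrite /singular_values perm_sort.
set p := char_poly _ in Hp *.
have p0 : p != 0 by apply: monic_neq0; apply: char_poly_monic.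
have -> : [seq nseq (mup x p) (Num.sqrt x) | x <- rootsR p] =
    [seq map Num.sqrt s | s <- [seq nseq (mup x p) x | x <- rootsR p]].
  by rewrite -map_comp; apply: eq_map => x /=; rewrite map_nseq.
rewrite -map_flatten; apply: perm_map.
apply/allP => z _ /=; rewrite count_flatten_nseq; last first.
  exact: uniq_roots.
have /(_ z) := roots_on_rootsR p0; rewrite /roots_on inE /= => Hz.
rewrite Hp mu_prod_XsubC -Hp.
rewrite -Hz Hp root_prod_XsubC.
case: (boolP (z \in r)) => [|/count_memPn ->]; first by rewrite muln1.
by [].
Qed.

Lemma sorted_second_le (R : realType) (s : seq R) (a : R) :
  sorted >=%R s -> nth 0 s 1 <= a -> (count (fun x => a < x)%R s <= 1)%N.
Proof.
case: s => [|x [|y s]] //=; first by rewrite addn0 => _ _; case: (_ < _).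
case/andP=> _ ps ya; rewrite (ltNge a y) ya add0n.
have /allP Hs : all (<= y) s.
  by apply: order_path_min ps => u v w /= ? ?; apply: le_trans; eassumption.
rewrite (_ : count _ s = 0%N) ?addn0; first by case: (_ < _).
apply/eqP; rewrite -leqn0 leqNgt -has_count; apply/hasPn => z /Hs zy.
by rewrite -leNgt (le_trans zy ya).
Qed.

(** * Spectral decomposition and the Rayleigh quotient *)

Section Rayleigh.
Local Open Scope sesquilinear_scope.
Variables (R : realType) (n : nat).
Local Notation C := (complex R).
Local Notation toC := (map_mx (real_complex R)).

Lemma toC_conj m p (u : 'M[R]_(m, p)) : map_mx Num.conj (toC u) = toC u.
Proof.
apply/matrixP => i j; rewrite !mxE; apply/CrealP.
by rewrite complex_real.
Qed.

(** A real symmetric matrix is Hermitian over the complex numbers and has real eigenvalues there;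
    hence [d] lives over [R] although [U] is complex. *)
Lemma symmetric_spectral (M : 'M[R]_n) : M^T = M ->
  exists (U : 'M[C]_n) (d : 'rV[R]_n),
    U \is unitarymx /\ toC M = U^t* *m diag_mx (toC d) *m U.
Proof.
move=> Msym.
have Mh : toC M \is hermsymmx.
  apply: realsym_hermsym.
    by apply/is_hermitianmxP; rewrite expr0 scale1r map_mx_id // map_trmx Msym.
  by apply/mxOverP => i j; rewrite mxE complex_real.
have /mxOverP Dr := hermitian_spectral_diag_real Mh.
have /orthomx_spectralP Mn := hermitian_normalmx Mh.
have Uu := spectral_unitarymx (toC M).
exists (spectralmx (toC M)), (map_mx (@complex.Re R) (spectral_diag (toC M))).
split=> //; rewrite {1}Mn invmx_unitary //; congr (_ *m diag_mx _ *m _).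
by apply/matrixP => i j; rewrite !mxE RRe_real.
Qed.

Lemma char_poly_spectral (M : 'M[R]_n) (U : 'M[C]_n) (d : 'rV[R]_n) :
  U \is unitarymx -> toC M = U^t* *m diag_mx (toC d) *m U ->
  char_poly M = \prod_i ('X - (d 0 i)%:P).
Proof.
move=> Uu HM; apply: (map_poly_inj (real_complex R)).
rewrite map_char_poly HM -invmx_unitary // char_poly_similar ?unitarymx_unit //.
rewrite char_poly_trig; last by apply/diag_mx_is_trig.
rewrite rmorph_prod; apply: eq_bigr => i _.
by rewrite rmorphB /= map_polyX map_polyC /= !mxE eqxx mulr1n.
Qed.

(** Parseval's identity for the orthonormal basis given by [U]. *)
Lemma dot_coord (U : 'M[C]_n) (u v : 'rV[R]_n) : U \is unitarymx ->
  ((u *m v^T) 0 0)%:C%C =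
  \sum_i (toC u *m U^t* ) 0 i * Num.conj ((toC v *m U^t* ) 0 i).
Proof.
move=> Uu; transitivity ((toC u *m U^t* *m (toC v *m U^t* )^t* ) 0 0).
  rewrite trmx_mul map_mxM trmxCK.
  rewrite mulmxA mulmxKtV // map_trmx toC_conj -map_mxM !mxE.
  by [].
by rewrite mxE; apply: eq_bigr => i _; rewrite !mxE.
Qed.

(** At most one eigenvalue of [A^T *m A] exceeds [a ^+ 2]. The constant vector has eigenvalue 1, so
    it occupies that exceptional direction, and a vector orthogonal to it only sees the other
    eigenvalues. *)
Lemma rayleigh_off_constants (A : 'M[R]_n) (a : R) (x : 'rV[R]_n) :
  (0 < n)%N -> 0 <= a -> a < 1 -> sigma2 A <= a ->
  (const_mx 1 : 'rV_n) *m (A^T *m A) = const_mx 1 ->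
  x *m (const_mx 1 : 'rV_n)^T = 0 ->
  (x *m (A^T *m A) *m x^T) 0 0 <= a ^+ 2 * (x *m x^T) 0 0.
Proof.
move=> n0 a0 a1 sA; set M := A^T *m A => M1 x1.
have Msym : M^T = M by rewrite trmx_mul trmxK.
have [U [d [Uu HM]]] := symmetric_spectral Msym.
pose co (u : 'rV[R]_n) := toC u *m U^t*.
have coM u i : co (u *m M) 0 i = co u 0 i * (d 0 i)%:C%C.
  by rewrite /co map_mxM HM !mulmxA mulmxtVK // mul_mx_diag !mxE.
have few : (#|[set i | (a < Num.sqrt (d 0 i))%R]| <= 1)%N.
  have Hp := char_poly_spectral Uu HM.
  have Hp' : char_poly M = \prod_(y <- [seq d 0 i | i <- enum 'I_n]) ('X - y%:P).
    by rewrite big_map big_enum.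
  have := singular_values_split Hp'.
  have /sorted_second_le /(_ sA) : sorted >=%R (singular_values A).
    by apply: sort_sorted => u v; exact: le_total.
  move=> H /seq.permP/(_ (fun x => a < x)) E; apply: leq_trans H; rewrite [leqRHS]E.
  rewrite -map_comp count_map cardE size_filter; apply: eq_leq.
  by rewrite enumT; apply: eq_count => i /=; rewrite inE.
(* Otherwise the constant vector would have norm 0, whereas its squared norm is [n]. *)
have [i0 i0P] : exists i, co (const_mx 1) 0 i != 0.
  apply/existsP; rewrite -negb_forall; apply/negP => /forallP H.
  have := dot_coord (const_mx 1) (const_mx 1) Uu.
  rewrite big1 => [|i _]; last by rewrite (eqP (H i)) mul0r.
  move=> [] /eqP; rewrite mxE; under eq_bigr do rewrite !mxE mulr1.
  by rewrite sumr_const card_ord pnatr_eq0 eqn0Ngt n0.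
have eig i : co (const_mx 1) 0 i != 0 -> d 0 i = 1.
  move=> ci; have := coM (const_mx 1) i; rewrite M1 -[LHS]mulr1.
  by move/(mulfI ci) => [].
have small i : i != i0 -> d 0 i <= a ^+ 2.
  move=> ii0; rewrite leNgt; apply/negP => ad.
  have : (#|[set i0; i]| <= 1)%N.
    apply: leq_trans few; apply: subset_leq_card; apply/subsetP => j.
    rewrite !inE => /orP[]/eqP->; first by rewrite (eig _ i0P) sqrtr1.
    by rewrite -(ger0_norm a0) -sqrtr_sqr ltr_sqrt // (le_lt_trans _ ad) // sqr_ge0.
  by rewrite cards2 eq_sym ii0.
(* Off [i0] the coordinates of the constant vector vanish, since a nonzero one would force an
   eigenvalue 1 there; so its inner product with [x] is the single term at [i0]. *)
have x0 : co x 0 i0 = 0.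
  have := dot_coord x (const_mx 1) Uu; rewrite x1 mxE.
  rewrite (bigD1 i0) //= big1 => [|i ii0].
    rewrite addr0 => /esym/eqP; rewrite mulf_eq0 conjC_eq0 (negbTE i0P) orbF.
    by move/eqP.
  have [->|/eig di] := eqVneq (co (const_mx 1) 0 i) 0.
    by rewrite conjC0 mulr0.
  have := small _ ii0; rewrite di => H.
  by have := expr_lt1 (isT : (0 < 2)%N) a0; rewrite a1 ltNge H.
rewrite -lecR rmorphM /= !(dot_coord _ _ Uu) mulr_sumr; apply: ler_sum => i _.
rewrite -/(co _) -/(co x) coM [_ * _%:C%C]mulrC -mulrA.
have [->|ii0] := eqVneq i i0; first by rewrite x0 !mul0r !mulr0.
by rewrite ler_wpM2r ?mul_conjC_ge0 // lecR small.
Qed.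
End Rayleigh.

(** * Tanner's inequality and vertex expansion *)

Definition nbhd n (G : sgraph n) (X : {set 'I_n}) : {set 'I_n} :=
  [set v | [exists u in X, G u v]].

Section Tanner.
Variables (R : realType) (n d : nat) (G : sgraph n).
Hypotheses (n_gt0 : (0 < n)%N) (d_gt0 : (0 < d)%N) (Gd : regular G d).
Let A := normalized_adjacency R G d.

Lemma normalized_adjacency_sym : A^T = A.
Proof. by apply/matrixP => u v; rewrite !mxE adj_sym. Qed.

Lemma normalized_adjacency_row u : \sum_v A u v = 1.
Proof.
under eq_bigr do rewrite mxE.
rewrite -mulr_suml -natr_sum.
have -> : (\sum_v (G u v : nat))%N = d.
  rewrite -(Gd u) -sum1_card [RHS]big_mkcond /=; apply: eq_bigr => v _.
  by rewrite inE; case: (G u v).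
by rewrite divff // pnatr_eq0 -lt0n.
Qed.

Lemma mul_const_adjacency : (const_mx 1 : 'rV_n) *m A = const_mx 1.
Proof.
apply/rowP => v; rewrite !mxE -[RHS](normalized_adjacency_row v).
by apply: eq_bigr => u _; rewrite mxE mul1r -{1}normalized_adjacency_sym [LHS]mxE.
Qed.

(** One random-walk step turns the indicator [e] of [X] into [f], of the same mass but supported on
    the neighbourhood [N]. Cauchy-Schwarz bounds the squared norm of [f] below by [x ^+ 2 / m]; the
    spectral gap bounds it above. *)
Lemma tanner (a : R) (X : {set 'I_n}) :
  0 <= a -> a < 1 -> sigma2 A <= a ->
  #|X|%:R <= #|nbhd G X|%:R * (#|X|%:R / n%:R + a ^+ 2) :> R.
Proof.
move=> a0 a1 sA.
have [->|X0] := eqVneq X set0.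
  by rewrite cards0 mulr_ge0 ?addr_ge0 ?divr_ge0 ?sqr_ge0.
set N := nbhd G X; set x : R := #|X|%:R; set m : R := #|N|%:R.
have n0 : n%:R != 0 :> R by rewrite pnatr_eq0 -lt0n.
have x_gt0 : 0 < x by rewrite ltr0n card_gt0.
pose e : 'rV[R]_n := \row_i (i \in X)%:R.
pose one : 'rV[R]_n := const_mx 1.
pose f : 'rV[R]_n := e *m A.
have sum_e : \sum_i e 0 i = x.
  rewrite /x -sum1_card natr_sum [RHS]big_mkcond /=; apply: eq_bigr => i _.
  by rewrite mxE; case: (i \in X).
have sum_ee : \sum_i e 0 i * e 0 i = x.
  rewrite -sum_e; apply: eq_bigr => i _.
  by rewrite mxE; case: (i \in X); rewrite ?mulr1 ?mulr0.
have sum_f : \sum_(v in N) f 0 v = x.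
  transitivity (\sum_v f 0 v).
    rewrite [RHS](bigID (mem N)) /= [X in _ = _ + X]big1 ?addr0 // => v vN.
    rewrite mxE big1 // => u _; rewrite !mxE.
    case: (boolP (u \in X)) => uX; rewrite ?mul0r // mul1r.
    case: (boolP (G u v)) => uv; rewrite ?mul0r //.
    by case/negP: vN; rewrite inE; apply/existsP; exists u; rewrite uX.
  under eq_bigr do rewrite mxE.
  rewrite exchange_big /= -sum_e; apply: eq_bigr => u _.
  by rewrite -mulr_sumr normalized_adjacency_row mulr1.
(* Here [y] is the part of [e] orthogonal to the constants. The constant part contributes exactly
   [x ^+ 2 / n%:R] to the squared norm of [f], and the Rayleigh bound applies to [y]. *)
have fn : \sum_v f 0 v ^+ 2 <= x ^+ 2 / n%:R + a ^+ 2 * x.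
  pose y := e - (x / n%:R) *: one.
  have one1 : (one *m one^T) 0 0 = n%:R.
    rewrite mxE; under eq_bigr do rewrite !mxE mulr1.
    by rewrite sumr_const card_ord.
  have e1 : (e *m one^T) 0 0 = x.
    by rewrite mxE -[RHS]sum_e; apply: eq_bigr => i _; rewrite !mxE mulr1.
  have y1 : y *m one^T = 0.
    apply/matrixP => i j; rewrite !ord1 mulmxBl -scalemxAl.
    by rewrite [LHS]mxE [X in _ + X]mxE [X in _ - X]mxE one1 e1 divfK // subrr [RHS]mxE.
  have oneA : one *m (A^T *m A) = one.
    by rewrite mulmxA normalized_adjacency_sym !mul_const_adjacency.
  have := rayleigh_off_constants n_gt0 a0 a1 sA oneA y1.
  have -> : (y *m (A^T *m A) *m y^T) 0 0 = \sum_v f 0 v ^+ 2 - x ^+ 2 / n%:R.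
    have E : e *m (A^T *m A) *m e^T = f *m f^T.
      by rewrite /f trmx_mul normalized_adjacency_sym !mulmxA.
    have yM1 : y *m (A^T *m A) *m one^T = 0.
      rewrite -mulmxA; have -> : (A^T *m A) *m one^T = one^T; last by [].
      by apply: trmx_inj; rewrite trmxK !trmx_mul !trmxK oneA.
    have -> : y *m (A^T *m A) *m y^T = y *m (A^T *m A) *m e^T.
      by rewrite {2}/y linearB /= linearZ /= mulmxBr -scalemxAr yM1 scaler0 subr0.
    rewrite {1}/y mulmxBl mulmxBl E -scalemxAl oneA -scalemxAl.
    rewrite mxE [X in _ + X]mxE [X in _ - X]mxE.
    have -> : (one *m e^T) 0 0 = x by rewrite -e1 -[one *m _]trmxK trmx_mul trmxK mxE.
    rewrite mxE; congr (_ - _); last by field.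
    by apply: eq_bigr => v _; rewrite [X in _ * X]mxE expr2.
  have -> : (y *m y^T) 0 0 = x - x ^+ 2 / n%:R.
    have -> : y *m y^T = y *m e^T.
      by rewrite {2}/y linearB /= linearZ /= mulmxBr -scalemxAr y1 scaler0 subr0.
    rewrite {1}/y mulmxBl -scalemxAl mxE [X in _ + X]mxE [X in _ - X]mxE.
    have -> : (one *m e^T) 0 0 = x by rewrite -e1 -[one *m _]trmxK trmx_mul trmxK mxE.
    rewrite mxE; congr (_ - _); last by field.
    by rewrite -[RHS]sum_ee; apply: eq_bigr => v _; rewrite [X in _ * X]mxE.
  have : 0 <= a ^+ 2 * (x ^+ 2 / n%:R) by rewrite mulr_ge0 ?divr_ge0 ?sqr_ge0.
  rewrite mulrBr; lra.
have fN : \sum_(v in N) f 0 v ^+ 2 <= \sum_v f 0 v ^+ 2.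
  by rewrite [leRHS](bigID (mem N)) /= lerDl; apply: sumr_ge0 => v _; rewrite sqr_ge0.
have m_gt0 : 0 < m.
  rewrite ltr0n lt0n; apply/eqP => /cards0_eq N0.
  by move: sum_f; rewrite N0 big_set0 => /eqP; rewrite eq_sym gt_eqF.
(* Cauchy-Schwarz, as nonnegativity of the variance of f on N *)
have : 0 <= \sum_(v in N) (f 0 v - x / m) ^+ 2.
  by apply: sumr_ge0 => v _; rewrite sqr_ge0.
have -> : \sum_(v in N) (f 0 v - x / m) ^+ 2 =
    \sum_(v in N) f 0 v ^+ 2 - x ^+ 2 / m.
  have -> : \sum_(v in N) (f 0 v - x / m) ^+ 2 =
      \sum_(v in N) (f 0 v ^+ 2 + (f 0 v * (- 2 * (x / m)) + (x / m) ^+ 2)).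
    by apply: eq_bigr => v _; ring.
  rewrite big_split big_split /= -mulr_suml sum_f sumr_const -/N -[_ *+ _]mulr_natr.
  by rewrite -/m; field; rewrite gt_eqF.
rewrite subr_ge0 => H.
have : x ^+ 2 / m <= x ^+ 2 / n%:R + a ^+ 2 * x by lra.
rewrite ler_pdivrMr // => H2.
rewrite -(ler_pM2l x_gt0) -expr2; apply: le_trans H2 _.
by rewrite le_eqVlt; apply/orP; left; apply/eqP; field.
Qed.

End Tanner.

(** The last factor in Tanner's inequality is at most 2/3 + 1/16 < 3/4, so the neighbourhood has at
    least 4/3 of the size of [X], and at least a third of that size lies outside [X]. *)
Lemma tanner_expansion (R : realType) n d (G : sgraph n) (X : {set 'I_n}) :
  (0 < d)%N -> regular G d ->
  sigma2 (normalized_adjacency R G d) <= 1 / 4 ->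
  (3 * #|X| <= 2 * n)%N -> (#|X| <= 3 * #|nbhd G X :\: X|)%N.
Proof.
move=> d0 Gd sA X23.
have [n0|n0] := posnP n; first by have := max_card (mem X); rewrite card_ord; lia.
have H : #|X|%:R <= #|nbhd G X|%:R * (#|X|%:R / n%:R + (1 / 4) ^+ 2) :> R.
  by apply: (tanner n0 d0 Gd) => //; lra.
have : (4 * #|X| <= 3 * #|nbhd G X|)%N.
  have n0' : 0 < n%:R :> R by rewrite ltr0n.
  have X23' : #|X|%:R / n%:R <= 2 / 3 :> R.
    rewrite ler_pdivrMr // mulrAC ler_pdivlMr // -!natrM ler_nat mulnC //.
  rewrite -(ler_nat R) !natrM.
  have : #|nbhd G X|%:R * (#|X|%:R / n%:R + (1/4)^+2) <= #|nbhd G X|%:R * (3/4) :> R.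
    by apply: ler_wpM2l => //; rewrite expr2; lra.
  lra.
have := cardsID X (nbhd G X); have := subset_leq_card (subsetIr (nbhd G X) X).
lia.
Qed.

(** * Robust expansion and greedy phases *)

Local Open Scope nat_scope.

(** * Balls in induced subgraphs and robust diameter *)

Section Balls.
Variables (n : nat) (G : sgraph n).
Implicit Types (B W X Y S : {set 'I_n}) (u v w x y z : 'I_n).

(** Distances are taken in the subgraph induced by [B]; the ball is empty when [v] is not in [B]. *)
Fixpoint ball B v r : {set 'I_n} :=
  if r is r'.+1 then ball B v r' :|: (B :&: nbhd G (ball B v r'))
  else B :&: [set v].

Lemma nbhdP X v : reflect (exists2 u, u \in X & G u v) (v \in nbhd G X).
Proof. by rewrite inE; apply: (iffP exists_inP). Qed.

Lemma nbhdS X Y : X \subset Y -> nbhd G X \subset nbhd G Y.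
Proof.
move=> /subsetP XY; apply/subsetP => v /nbhdP[u uX uv].
by apply/nbhdP; exists u; rewrite ?XY.
Qed.

Lemma ball_sub B v r : ball B v r \subset B.
Proof.
elim: r => [|r IH] /=; first exact: subsetIl.
by rewrite subUset IH subsetIl.
Qed.

Lemma ballS B B' v r : B \subset B' -> ball B v r \subset ball B' v r.
Proof.
move=> BB; elim: r => [|r IH] /=; first exact: setSI.
by apply: setUSS => //; apply: setISS => //; apply: nbhdS.
Qed.

Lemma ball_leq B v r s : r <= s -> ball B v r \subset ball B v s.
Proof.
move=> /subnK <-; elim: (s - r) => [|k IH] //=.
by rewrite (subset_trans IH) ?subsetUl.
Qed.

Lemma ball_trans B y z r s :
  z \in ball B y r -> ball B z s \subset ball B y (r + s).
Proof.
move=> zr; elim: s => [|s IH].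
  by rewrite addn0; apply/subsetP => v; rewrite !inE => /andP[_ /eqP->].
by rewrite addnS /=; apply: setUSS => //; apply: setIS; apply: nbhdS.
Qed.

Lemma ball_sym B x z r : z \in ball B x r -> x \in ball B z r.
Proof.
elim: r z => [|r IH] z; first by rewrite !inE => /andP[zB /eqP<-]; rewrite zB eqxx.
rewrite /= inE => /orP[/IH|]; first exact/subsetP/(ball_leq B z (leqnSn r)).
rewrite inE => /andP[zB /nbhdP[w wr wz]].
have wB : w \in B by apply: (subsetP (ball_sub B x r)).
have : w \in ball B z 1.
  rewrite /= inE; apply/orP; right; rewrite inE wB; apply/nbhdP.
  by exists z; rewrite ?inE ?zB ?eqxx // adj_sym.
by move/(ball_trans r)/subsetP/(_ _ (IH _ wr)).
Qed.

Hypothesis expansion :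
  forall X, 3 * #|X| <= 2 * n -> #|X| <= 3 * #|nbhd G X :\: X|.

(* The deleted part is a largest set whose boundary outside S is small: what
   remains expands, for a non-expanding set could be added to it. *)
Lemma expanding_core S : 36 * #|S| <= n ->
  exists W, [/\ S \subset W, #|W| <= 7 * #|S| &
    forall Y, Y \subset ~: W -> Y != set0 -> 2 * #|Y| <= n ->
      #|Y| < 6 * #|~: W :&: (nbhd G Y :\: Y)|].
Proof.
move=> Sn.
pose P X := [&& [disjoint X & S], 3 * #|X| <= 2 * n &
  6 * #|nbhd G X :\: X :\: S| <= #|X|].
have P0 : P set0.
  rewrite /P cards0 muln0 /= -setI_eq0 set0I eqxx /= leqn0 muln_eq0 cards_eq0.
  rewrite -subset0; apply/subsetP => v; rewrite !inE => /and3P[_ _ /existsP[u]].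
  by rewrite inE.
case: (arg_maxnP (fun X : {set 'I_n} => #|X|) P0) => X /and3P[XS Xn XP] Xmax.
(* Expansion gives |X| <= 3 (|S| + |X| / 6), the boundary of [X] being split into its parts inside
   and outside [S]. *)
have Xsmall : #|X| <= 6 * #|S|.
  have := expansion Xn; have := cardsID S (nbhd G X :\: X).
  have := subset_leq_card (subsetIr (nbhd G X :\: X) S); lia.
exists (S :|: X); split; first exact: subsetUl.
  by rewrite cardsU; lia.
move=> Y YW Y0 Yn; rewrite ltnNge; apply/negP => Ysmall.
have XY : [disjoint X & Y].
  rewrite disjoint_sym -setI_eq0 -subset0; apply/subsetP => v; rewrite inE => /andP[vY vX].
  by have := subsetP YW _ vY; rewrite !inE vX orbT.
have cXY : #|X :|: Y| = #|X| + #|Y|.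
  by rewrite cardsU; move: XY; rewrite -setI_eq0 => /eqP->; rewrite cards0 subn0.
(* A non-expanding [Y] could be joined to [X], against maximality. The size condition holds because
   |X| <= 6 |S| <= n / 6 and |Y| <= n / 2 add up to 2n / 3. *)
have : P (X :|: Y).
  apply/and3P; split.
  - rewrite -setI_eq0 setIUl setU_eq0 setI_eq0 XS /= -subset0.
    apply/subsetP => v; rewrite inE => /andP[vY vS].
    by have := subsetP YW _ vY; rewrite !inE vS.
  - rewrite cXY; lia.
  rewrite cXY; apply: leq_trans (leq_add XP Ysmall).
  rewrite -mulnDr leq_mul2l /=; apply: leq_trans (leq_card_setU _ _).
  apply: subset_leq_card; apply/subsetP => v; rewrite !(in_setD, in_setU, in_setI, in_setC).
  case/and3P => vS vXY /nbhdP[u uXY uv].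
  move: vXY; rewrite negb_or => /andP[vX vY].
  rewrite vX vY vS /= (negbTE vS) (negbTE vX) /=.
  apply/orP; move: uXY; rewrite inE => /orP[] h; [left|right];
    by apply/nbhdP; exists u.
move/Xmax; rewrite cXY; move: Y0; rewrite -card_gt0; lia.
Qed.

(** As long as a ball fills at most half of the vertices, its boundary adds more than a sixth of its
    size, a growth factor of 7/6 per step. *)
Lemma ball_growth W v r : v \notin W ->
  (forall Y, Y \subset ~: W -> Y != set0 -> 2 * #|Y| <= n ->
      #|Y| < 6 * #|~: W :&: (nbhd G Y :\: Y)|) ->
  n < 2 * #|ball (~: W) v r| \/ 7 ^ r <= 6 ^ r * #|ball (~: W) v r|.
Proof.
move=> vW HW.
have v0 : v \in ball (~: W) v 0 by rewrite !inE vW eqxx.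
elim: r => [|r IH].
  by right; rewrite !expn0 mul1n card_gt0; apply/set0Pn; exists v.
have sub : ball (~: W) v r \subset ball (~: W) v r.+1 by apply: ball_leq.
case: (leqP (2 * #|ball (~: W) v r|) n) => [small|big]; last first.
  by left; apply: leq_trans big _; rewrite leq_mul2l subset_leq_card.
case: IH => [|IH]; first by rewrite ltnNge small.
right; set Y := ball _ _ r in IH small *.
have /(HW Y (ball_sub _ _ _)) /(_ small) : Y != set0.
  by apply/set0Pn; exists v; apply: (subsetP (ball_leq _ _ (leq0n r))).
have -> : #|ball (~: W) v r.+1| = #|Y| + #|~: W :&: (nbhd G Y :\: Y)|.
  rewrite /= -/Y.
  rewrite -(cardsID Y (Y :|: _)) setUK; congr (_ + #|pred_of_set _|).
  by rewrite setDUl setDv set0U setIDA.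
rewrite !expnS; nia.
Qed.

(** Balls of radius [5 * l] around two surviving vertices each contain more than half of all
    vertices, so they meet, and the two radii add up to the factor 10. *)
Lemma robust_diameter S : 36 * #|S| <= n ->
  exists W, [/\ S \subset W, #|W| <= 7 * #|S| &
    forall x y, x \notin W -> y \notin W ->
      x \in ball (~: S) y (10 * up_log 2 n)].
Proof.
move=> /expanding_core[W [SW Wc HW]]; exists W; split=> // x y xW yW.
set l := up_log 2 n; pose b v := ball (~: W) v (5 * l).
have big v : v \notin W -> n < 2 * #|b v|.
  move=> vW; case: (ball_growth (5 * l) vW HW) => //.
  have : 0 < n by case: (n) v {vW} => // -[].
  have : n <= 2 ^ l by apply: up_logP.
  rewrite !expnM -/(b v) => nl n0.
  (* Five steps of growth by 7/6 more than double the ball; this is the origin of the radius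
     [5 * l]. *)
  have : 6 ^ 5 * 2 <= 7 ^ 5 by rewrite !expnS !expn0; lia.
  have : 0 < 6 ^ 5 by rewrite expn_gt0.
  move: (6 ^ 5) (7 ^ 5) => s t s0 st H; have {}H : 2 ^ l <= #|b v|.
    rewrite -(@leq_pmul2l (s ^ l)) ?expn_gt0 ?s0 //.
    by apply: leq_trans H; rewrite -expnMn; case: (l) => // k; rewrite leq_exp2r.
  lia.
have [z] : exists z, z \in b x :&: b y.
  apply/set0Pn; rewrite -card_gt0; have := big x xW; have := big y yW.
  have := subset_leq_card (subsetT (b x :|: b y)); rewrite cardsU cardsT card_ord.
  by move: #|b x :&: b y| #|b x| #|b y| => i p q; lia.
rewrite inE => /andP[zx zy].
have {}zx := ball_sym zx.
have := subsetP (ball_trans _ zy) _ zx.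
rewrite -mulnDl -[_ + _]/10 => h; apply: (subsetP _ _ h); apply: ballS.
by rewrite setCS.
Qed.

End Balls.

(** * Greedy phases *)

Section Greedy.
Variables (n : nat) (G : sgraph n) (pi : {perm 'I_n}) (L : nat).
Implicit Types (P Q : seq (seq 'I_n)) (u v : 'I_n).

Definition allowed P T : {set 'I_n} := [set v | load P v < T].

Definition good_path (p : seq 'I_n) := is_path G p && (size p <= L.+1).

(* What a phase started from P0 with threshold T has achieved once the vertices
   numbered i or more have been treated. *)
Definition phase_inv T P0 i P :=
  [/\ exists2 Q, P = P0 ++ Q &
        all good_path Q /\ size Q + #|unrouted pi P| <= #|unrouted pi P0|,
      forall v, load P v <= T
    & forall u, i <= u -> u \in unrouted pi P ->
        u \notin ball G (allowed P T) (pi u) L].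

Lemma load_rcons P p v : load (rcons P p) v = load P v + (v \in p).
Proof. by rewrite /load -cats1 count_cat /= addn0. Qed.

Lemma unrouted_rcons P p :
  unrouted pi (rcons P p) = unrouted pi P :\: [set u | joins p u (pi u)].
Proof. by apply/setP => u; rewrite !inE has_rcons negb_or. Qed.

(** The scan runs downwards, so at index [n] no vertex has been treated yet. *)
Lemma phase_inv0 T K P : (forall v, load P v <= T) ->
  phase_inv (T + K) P n P.
Proof.
move=> HT; split=> //; first by exists [::]; rewrite ?cats0.
  by move=> v; rewrite (leq_trans (HT v)) ?leq_addr.
by move=> u; rewrite leqNgt ltn_ord.
Qed.

Lemma phase_inv_routed T P0 P u :
  phase_inv T P0 u.+1 P -> u \notin unrouted pi P -> phase_inv T P0 u P.
Proof.
case=> HQ HT Hu uP; split=> // w; rewrite leq_eqVlt => /orP[/eqP/val_inj<-|/Hu//].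
by rewrite (negbTE uP).
Qed.

Lemma phase_inv_unreachable T P0 P u :
  phase_inv T P0 u.+1 P -> u \notin ball G (allowed P T) (pi u) L ->
  phase_inv T P0 u P.
Proof.
case=> HQ HT Hu uP; split=> // w.
by rewrite leq_eqVlt => /orP[/eqP/val_inj<-|/Hu].
Qed.

(** A new path only raises loads, so the allowed set shrinks and earlier failed searches remain
    failures. The path routes [u], which pays for the extra unit of [size Q], and it visits only
    vertices with room for one more path. *)
Lemma phase_inv_rcons T P0 P u p :
  phase_inv T P0 u.+1 P -> u \in unrouted pi P ->
  good_path p -> joins p u (pi u) -> {subset p <= allowed P T} ->
  phase_inv T P0 u (rcons P p).
Proof.
case=> [[Q ->] [gQ cQ] HT Hu uP] gp jp pA; split.
- exists (rcons Q p); rewrite ?rcons_cat // all_rcons gp size_rcons; split=> //.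
  rewrite -rcons_cat unrouted_rcons addSnnS; apply: leq_trans cQ.
  rewrite leq_add2l; apply: proper_card; apply/properP; split; first exact: subsetDl.
  by exists u; rewrite // !inE jp.
- move=> v; rewrite load_rcons; case: (boolP (v \in p)) => [/pA|_].
    by rewrite inE addn1.
  by rewrite addn0.
move=> w wu; rewrite unrouted_rcons => /setDP[wP]; rewrite inE => wj.
have : u < w.
  move: wu; rewrite leq_eqVlt => /orP[/eqP/val_inj wu|//].
  by move: wj; rewrite -wu jp.
move/Hu => /(_ wP); apply: contra; apply/subsetP/ballS; apply/subsetP => v.
by rewrite !inE load_rcons; apply: leq_ltn_trans; rewrite leq_addr.
Qed.

Lemma sum_load P : all good_path P -> \sum_v load P v <= size P * L.+1.
Proof.
elim: P => [|p P IH] /=; first by rewrite big1.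
case/andP=> /andP[pp sp] /IH {}IH.
rewrite mulSn; apply: leq_trans (leq_add sp IH).
have up : uniq p by case: (p) pp => //= x q /andP[_].
by rewrite big_split /= leq_add2r -(card_uniqP up) -sum1_card [leqRHS]big_mkcond.
Qed.

Hypothesis expansion :
  forall X : {set 'I_n}, 3 * #|X| <= 2 * n -> #|X| <= 3 * #|nbhd G X :\: X|.
Hypothesis L_large : L = 10 * up_log 2 n.

Lemma phase_halves T P0 P :
  (forall v, load P0 v <= T) -> phase_inv (T + 36 * L.+1) P0 0 P ->
  2 * #|unrouted pi P| <= #|unrouted pi P0|.
Proof.
move=> H0 [[Q PQ [gQ cQ]] HT Hu].
set m := #|unrouted pi P0| in cQ *.
pose S := ~: allowed P (T + 36 * L.+1).
(* Every vertex of [S] gained at least [36 * L.+1] during the phase, while the at most [m] new paths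
   add at most [m * L.+1] to the loads in total. *)
have Sm : 36 * #|S| <= m.
  rewrite -(@leq_pmul2r L.+1) //.
  apply: (@leq_trans (\sum_v load Q v)); last first.
    by apply: leq_trans (sum_load gQ) _; rewrite leq_mul2r; lia.
  rewrite mulnAC mulnC -sum_nat_const [leqRHS](bigID (mem S)) /=.
  apply: leq_trans (leq_addr _ _); apply: leq_sum => v.
  rewrite !inE -leqNgt PQ /load count_cat; have := H0 v; rewrite /load; lia.
have mn : m <= n by rewrite -[leqRHS]card_ord max_card.
have [W [SW Wc HW]] := robust_diameter expansion (leq_trans Sm mn).
(* If both [u] and [pi u] avoid [W], the search for [u] would have succeeded. The union has at most
   14 |S| elements, and 28 |S| <= 36 |S| <= m. *)
have sub : unrouted pi P \subset W :|: pi @^-1: W.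
  apply/subsetP => u uP; rewrite !inE -[_ || _]negbK negb_or.
  apply/negP => /andP[uW puW].
  have := Hu u (leq0n u) uP; rewrite L_large.
  by have := HW _ _ uW puW; rewrite setCK -L_large => ->.
have := subset_leq_card sub; have := leq_card_setU W (pi @^-1: W).
rewrite (card_preimset _ (@perm_inj _ pi)) => -[h _]; lia.
Qed.

End Greedy.

(** * Breadth-first labels *)

Section Labels.
Variables (n : nat) (G : sgraph n) (B : {set 'I_n}) (v : 'I_n).
Implicit Types (D par : nat -> nat) (t : nat -> nat -> bool) (x y : 'I_n).

(* D x is 0 if x has not been reached, and otherwise one more than the length of
   the path from x to v obtained by following the pointers par. *)
Definition labels D par := forall x, D x <> 0 ->
  x \in B /\ (D x = 1 /\ x = v \/
    exists2 y : 'I_n, par x = y & [/\ G x y, D x = (D y).+1 & D y <> 0]).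

(** Labels drop by one along each pointer, so the chain from [x] stops at [v] after [q] steps and
    cannot revisit a vertex. *)
Lemma labels_path D par x q : labels D par -> D x = q.+1 ->
  exists p, [/\ path (fun a b => G a b && (par a == b)) x p, last x p = v,
    size p = q, uniq (x :: p) & {in x :: p, forall y, 0 < D y <= q.+1}].
Proof.
move=> lab; elim: q x => [|q IH] x Dx; have [//|_] := lab x; rewrite Dx //.
  case=> [[_ <-]|[y _ [_ [<-]]] //]; exists [::]; split=> // y.
  by rewrite inE => /eqP->; rewrite Dx.
case=> [[//]|[y pxy [xy [/esym Dy] _]]]; have [p [pp lp sp up Dp]] := IH y Dy.
exists (y :: p); split=> //=; first by rewrite xy pxy eqxx.
- by rewrite sp.
- rewrite -[_ && uniq p]/(uniq (y :: p)) up andbT; apply/negP => /Dp.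
  by rewrite Dx ltnn andbF.
move=> z; rewrite inE => /orP[/eqP->|/Dp /andP[-> h]]; first by rewrite Dx leqnn.
exact: leqW.
Qed.

(** State after [j] rounds: the upper bound on labels controls path lengths, the last clause makes
    the search complete. *)
Definition bfs_inv j D par :=
  [/\ labels D par, forall x, D x <= j.+1 &
      forall x, x \in ball G B v j -> D x <> 0].

(** State inside the next round, where [treated] marks the ordered pairs already scanned. Labels in
    the ball of radius [j] stay at most [j.+1], so these vertices keep passing the test for
    propagating a label in this round. *)
Definition round_inv j (treated : nat -> nat -> bool) D par :=
  [/\ labels D par, forall x, D x <= j.+2,
      forall x, x \in ball G B v j -> 0 < D x <= j.+1
    & forall x y, treated x y -> G x y -> y \in ball G B v j -> x \in B ->
        D x <> 0].

Lemma round_inv_start j D par :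
  bfs_inv j D par -> round_inv j (fun _ _ => false) D par.
Proof.
case=> lab le bal; split=> // x; first exact: leqW.
by move=> /bal /eqP; rewrite lt0n => -> /=.
Qed.

Lemma round_inv_sub j t t' D par :
  round_inv j t D par -> (forall x y, t' x y -> t x y) -> round_inv j t' D par.
Proof. by case=> lab le bal tr tt; split=> // x y /tt; apply: tr. Qed.

Lemma round_inv_end j D par :
  round_inv j (fun _ _ => true) D par -> bfs_inv j.+1 D par.
Proof.
case=> lab le bal tr; split=> // x /=; rewrite inE => /orP[/bal/andP[]|].
  by rewrite lt0n => /eqP.
rewrite inE => /andP[xB /nbhdP[y yb yx]]; apply: (tr x y) => //.
by rewrite adj_sym.
Qed.

Lemma round_inv_keep j t D par x y :
  round_inv j t D par ->
  ~ [/\ G x y, D x = 0, 0 < D y <= j.+1 & x \in B] ->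
  round_inv j (fun a b => t a b || (a == x) && (b == y)) D par.
Proof.
case=> lab le bal tr H; split=> // a b /orP[/tr //|].
move=> /andP[/eqP/val_inj-> /eqP/val_inj->] xy /bal Dy xB Dx.
by apply: H.
Qed.

(** Pointers of labelled vertices lead to labelled vertices, so no chain passes through the
    unlabelled [x], and overwriting its entries disturbs no existing chain. *)
Lemma round_inv_set j t D par x y :
  round_inv j t D par ->
  G x y -> D x = 0 -> 0 < D y <= j.+1 -> x \in B ->
  round_inv j (fun a b => t a b || (a == x) && (b == y))
    (update D x (D y).+1) (update par x y).
Proof.
case=> lab le bal tr xy Dx /andP[Dy0 Dy] xB.
have upd a : D a <> 0 -> update D x (D y).+1 a = D a.
  by rewrite /update; case: eqP => // ->.
have yx : y != x by apply: contraTneq Dy0 => ->; rewrite Dx.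
split.
- move=> a; rewrite {1}/update; case: eqP => [/val_inj-> _|ne /[dup] Da /lab[aB h]].
    split=> //; right; exists y; first by rewrite /update eqxx.
    by split=> //; rewrite ?[update D _ _ y]upd ?{1}/update ?eqxx //; apply/eqP; rewrite -lt0n.
  rewrite upd //; split=> //; case: h => [|[b pb [ab Dab Db]]]; [by left | right].
  by exists b; [rewrite /update; case: eqP ne | split; rewrite // upd].
- by move=> a; rewrite /update; case: eqP => // _; apply: leq_trans (le a) _.
- move=> a /bal; rewrite /update; case: eqP => // /val_inj->.
  by rewrite Dx.
move=> a b /orP[tab ab bb aB|/andP[/eqP/val_inj-> _] _ _ _].
  by rewrite upd //; apply: tr tab ab bb aB.
by rewrite /update eqxx.
Qed.

End Labels.

(** * Program verification *)

Section Verification.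
Variable B : nat.

(* [cost c] bounds the running time of [c] provided that no loop is executed
   more than [B] times in a row. *)
Fixpoint cost (c : prog) : nat :=
  match c with
  | Seq c1 c2 => cost c1 + cost c2
  | If _ c1 c2 => (cost c1 + cost c2).+1
  | While _ c => (B * (cost c).+1).+1
  | _ => 1
  end.

(** Total correctness with the time bound built in, so that the proof rules deliver termination and
    running time together. *)
Definition wp (c : prog) (Q : memory -> Prop) (s : memory) : Prop :=
  exists t s', [/\ runs c s t s', t <= cost c & Q s'].

Fixpoint wregs (c : prog) : seq nat :=
  match c with
  | Const x _ | Add x _ _ | Sub x _ _ | Read x _ _ => [:: x]
  | Write _ _ _ => [::]
  | Seq c1 c2 | If _ c1 c2 => wregs c1 ++ wregs c2
  | While _ c => wregs c
  end.

Fixpoint warrs (c : prog) : seq nat :=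
  match c with
  | Write a _ _ => [:: a]
  | Seq c1 c2 | If _ c1 c2 => warrs c1 ++ warrs c2
  | While _ c => warrs c
  | _ => [::]
  end.

Lemma runs_reg c s t s' x : runs c s t s' -> x \notin wregs c ->
  reg s' x = reg s x.
Proof.
elim=> {c s t s'} //=.
- by move=> s y k; rewrite inE /update => /negbTE->.
- by move=> s y z w; rewrite inE /update => /negbTE->.
- by move=> s y z w; rewrite inE /update => /negbTE->.
- by move=> s y a z; rewrite inE /update => /negbTE->.
- by move=> c1 c2 s1 s2 s3 t1 t2 _ IH1 _ IH2; rewrite mem_cat => /norP[h1 h2];
    rewrite IH2 ?IH1.
- by move=> y c1 c2 s t s' _ _ IH; rewrite mem_cat => /norP[h1 h2]; rewrite IH.
- by move=> y c1 c2 s t s' _ _ IH; rewrite mem_cat => /norP[h1 h2]; rewrite IH.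
by move=> y c s1 s2 s3 t1 t2 _ _ IH1 _ IH2 h; rewrite IH2 ?IH1.
Qed.

Lemma runs_arr c s t s' a : runs c s t s' -> a \notin warrs c ->
  arr s' a = arr s a.
Proof.
elim=> {c s t s'} //=.
- by move=> s b x y; rewrite inE /update => /negbTE->.
- by move=> c1 c2 s1 s2 s3 t1 t2 _ IH1 _ IH2; rewrite mem_cat => /norP[h1 h2];
    rewrite IH2 ?IH1.
- by move=> y c1 c2 s t s' _ _ IH; rewrite mem_cat => /norP[h1 h2]; rewrite IH.
- by move=> y c1 c2 s t s' _ _ IH; rewrite mem_cat => /norP[h1 h2]; rewrite IH.
by move=> y c s1 s2 s3 t1 t2 _ _ IH1 _ IH2 h; rewrite IH2 ?IH1.
Qed.

(** The consequence rule combined with a frame rule: whatever the program text does not write is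
    known to be unchanged. *)
Lemma wp_conseq c Q Q' s :
  wp c Q s ->
  (forall s', (forall x, x \notin wregs c -> reg s' x = reg s x) ->
     (forall a, a \notin warrs c -> arr s' a = arr s a) -> Q s' -> Q' s') ->
  wp c Q' s.
Proof.
move=> [t [s' [r tc q]]] h; exists t, s'; split=> //; apply: h => // z.
  exact: runs_reg r.
exact: runs_arr r.
Qed.

Lemma wp_const x k Q s : Q (set_reg s x k) -> wp (Const x k) Q s.
Proof. by move=> q; exists 1, (set_reg s x k); split=> //; constructor. Qed.

Lemma wp_add x y z Q s :
  Q (set_reg s x (reg s y + reg s z)) -> wp (Add x y z) Q s.
Proof. by move=> q; exists 1, (set_reg s x (reg s y + reg s z)); split=> //; constructor. Qed.

Lemma wp_sub x y z Q s :
  Q (set_reg s x (reg s y - reg s z)) -> wp (Sub x y z) Q s.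
Proof. by move=> q; exists 1, (set_reg s x (reg s y - reg s z)); split=> //; constructor. Qed.

Lemma wp_read x a y Q s :
  Q (set_reg s x (arr s a (reg s y))) -> wp (Read x a y) Q s.
Proof. by move=> q; exists 1, (set_reg s x (arr s a (reg s y))); split=> //; constructor. Qed.

Lemma wp_write a x y Q s :
  Q (set_arr s a (reg s x) (reg s y)) -> wp (Write a x y) Q s.
Proof. by move=> q; exists 1, (set_arr s a (reg s x) (reg s y)); split=> //; constructor. Qed.

Lemma wp_seq c1 c2 Q s : wp c1 (wp c2 Q) s -> wp (Seq c1 c2) Q s.
Proof.
move=> [t1 [s1 [r1 h1 [t2 [s2 [r2 h2 q]]]]]].
by exists (t1 + t2), s2; split; [apply: RunSeq r1 r2 | apply: leq_add | ].
Qed.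

Lemma wp_if x c1 c2 Q s :
  (reg s x <> 0 -> wp c1 Q s) -> (reg s x = 0 -> wp c2 Q s) ->
  wp (If x c1 c2) Q s.
Proof.
move=> h1 h2; have [x0|x0] := eqVneq (reg s x) 0.
  have [t [s' [r h q]]] := h2 x0; exists t.+1, s'; split=> //=.
    exact: RunIfFalse r.
  by rewrite ltnS (leq_trans h) ?leq_addl.
have [t [s' [r h q]]] := h1 (elimN eqP x0); exists t.+1, s'; split=> //=.
  exact: RunIfTrue r.
by rewrite ltnS (leq_trans h) ?leq_addr.
Qed.

(** The index of [I] bounds the number of remaining iterations; it must be positive whenever the
    test succeeds. *)
Lemma wp_while x c (I : nat -> memory -> Prop) m Q s :
  m <= B -> I m s ->
  (forall k s, I k s -> reg s x = 0 -> Q s) ->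
  (forall k s, I k s -> reg s x <> 0 ->
     exists2 k', k = k'.+1 & wp c (I k') s) ->
  wp (While x c) Q s.
Proof.
move=> mB Im Iq Is.
suff [t [s' [r h q]]] : exists t s',
    [/\ runs (While x c) s t s', t <= (m * (cost c).+1).+1 & Q s'].
  exists t, s'; split=> //=; apply: leq_trans h _.
  by rewrite ltnS leq_mul2r mB orbT.
elim: m s Im {mB} => [|m IH] s Im; have [x0|/eqP x0] := eqVneq (reg s x) 0.
- by exists 1, s; split=> //; [constructor | apply: Iq Im x0].
- by have [] := Is _ _ Im x0.
- by exists 1, s; split=> //; [constructor | apply: Iq Im x0].
have [_ [<-] [t1 [s1 [r1 h1 /IH[t2 [s2 [r2 h2 q]]]]]]] := Is _ _ Im x0.
exists (t1 + t2).+1, s2; split=> //.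
  by apply: RunWhileTrue r1 r2; apply/eqP.
by rewrite mulSn; lia.
Qed.

End Verification.

Fixpoint prog_size (c : prog) : nat :=
  match c with
  | Seq c1 c2 | If _ c1 c2 => (prog_size c1 + prog_size c2).+1
  | While _ c => (prog_size c).+1
  | _ => 1
  end.

(** For a fixed program the cost is a polynomial in [B] whose degree is the nesting depth of loops;
    the program size bounds both this degree and the leading factor. *)
Lemma cost_poly B c : cost B c <= prog_size c * B.+1 ^ prog_size c.
Proof.
have pos k : 0 < B.+1 ^ k by rewrite expn_gt0.
elim: c => [x k|x y z|x y z|x a y|a x y|c1 IH1 c2 IH2|x c1 IH1 c2 IH2|x c IH] /=;
  rewrite ?mul1n ?pos //.
- set a := prog_size c1 in IH1 *; set b := prog_size c2 in IH2 *.
  have h1 : B.+1 ^ a <= B.+1 ^ (a + b).+1 by apply: leq_pexp2l; lia.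
  have h2 : B.+1 ^ b <= B.+1 ^ (a + b).+1 by apply: leq_pexp2l; lia.
  nia.
- set a := prog_size c1 in IH1 *; set b := prog_size c2 in IH2 *.
  have h1 : B.+1 ^ a <= B.+1 ^ (a + b).+1 by apply: leq_pexp2l; lia.
  have h2 : B.+1 ^ b <= B.+1 ^ (a + b).+1 by apply: leq_pexp2l; lia.
  have := pos (a + b).+1; nia.
rewrite expnS; have := pos (prog_size c); move: (B.+1 ^ _) IH => e; nia.
Qed.

(* Registers 1 and 2 are reserved for the constants 1 and 0. *)
Local Notation one := 1 (only parsing).
Local Notation zero := 2 (only parsing).

(** Register 30 is read by no program. *)
Definition skip := Const 30 0.

(* [i] runs through [reg lim - 1, ..., 0]. *)
Definition For (i lim : nat) (body : prog) : prog :=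
  Seq (Add i lim zero) (While i (Seq (Sub i i one) body)).

(** As the counter descends, [I k] describes the state once all indices from [k] upwards have been
    processed. *)
Lemma wp_for B i lim body (I : nat -> memory -> Prop) Q s :
  i != one -> one \notin wregs body -> i \notin wregs body ->
  reg s one = 1 -> reg s zero = 0 -> reg s lim <= B ->
  I (reg s lim) (set_reg s i (reg s lim)) ->
  (forall k s', k < reg s lim -> I k.+1 s' ->
     (forall x, x != i -> x \notin wregs body -> reg s' x = reg s x) ->
     (forall a, a \notin warrs body -> arr s' a = arr s a) ->
     wp B body (I k) (set_reg s' i k)) ->
  (forall s', I 0 s' ->
     (forall x, x != i -> x \notin wregs body -> reg s' x = reg s x) ->
     (forall a, a \notin warrs body -> arr s' a = arr s a) -> Q s') ->
  wp B (For i lim body) Q s.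
Proof.
move=> i1 ob ib s1 s0 limB I0 Is IQ; apply: wp_seq; apply: wp_add.
rewrite s0 addn0; set N := reg s lim in limB I0 Is *.
pose J k s' := [/\ I k s', reg s' i = k, k <= N,
  forall x, x != i -> x \notin wregs body -> reg s' x = reg s x &
  forall a, a \notin warrs body -> arr s' a = arr s a].
apply: (@wp_while _ _ _ J N) => //.
- split=> //=; first by rewrite /update eqxx.
  by move=> x /negbTE xi _; rewrite /update xi.
- by move=> k s' [Ik ik _ hr ha]; rewrite ik => k0; apply: IQ; rewrite // -k0.
move=> k s' [Ik ik kN hr ha]; rewrite ik; case: k Ik ik kN => [|k] // Ik ik kN _.
exists k => //; apply: wp_seq; apply: wp_sub.
rewrite ik [reg s' one]hr ?s1 1?eq_sym // subn1 /=.
apply: wp_conseq (Is _ _ kN Ik hr ha) _ => s'' hr' ha' Ik'; split=> //.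
- by rewrite hr' //= /update eqxx.
- exact: ltnW.
- by move=> x xi xb; rewrite hr' //= /update (negbTE xi) hr.
by move=> a ab; rewrite ha' //= ha.
Qed.

(** * The routing program *)

(* Arrays: 0 adjacency matrix, 1 permutation, 2 output, 3 loads, 4 routed
   vertices, 5 labels and 6 pointers of the breadth-first search.
   Registers: 0 n, 3 path length bound, 4 threshold increment, 5 threshold,
   9 source, 10 target, 11 number of paths, 12 end of the output, 20 n * n;
   the others are loop counters and temporaries. *)
Definition clear := For 14 0 (Write 5 14 2).

(** The truncated difference of threshold and load is nonzero exactly when the load is below the
    threshold; the target receives label 1 only then. *)
Definition start :=
  Seq (Read 17 3 10) (Seq (Sub 17 5 17) (If 17 (Write 5 10 1) skip)).

(** Registers 14 and 15 hold [x] and [y], and 16 descends through the row-major positions of the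
    matrix, which avoids multiplication. The tests are: edge, [x] unlabelled, [y] labelled, label of
    [y] at most register 22, load of [x] below the threshold. *)
Definition relax :=
  Seq (Sub 16 16 1) (Seq (Read 17 0 16) (If 17
    (Seq (Read 18 5 14) (If 18 skip
      (Seq (Read 19 5 15) (If 19
        (Seq (Sub 21 19 22) (If 21 skip
          (Seq (Read 23 3 14) (Seq (Sub 23 5 23) (If 23
            (Seq (Add 18 19 1) (Seq (Write 5 14 18) (Write 6 14 15)))
            skip)))))
        skip))))
    skip)).

Definition round :=
  Seq (Sub 22 3 13) (Seq (Add 16 20 2) (For 14 0 (For 15 0 relax))).

Definition bfs := Seq clear (Seq start (For 13 3 round)).

Definition emit :=
  Seq (Write 2 12 24) (Seq (Add 12 12 1) (Seq (Read 17 3 24)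
    (Seq (Add 17 17 1) (Seq (Write 3 24 17) (Read 24 6 24))))).

(** The search started at the target, so following pointers from the source writes the path in its
    final order. *)
Definition emit_path :=
  Seq (Write 2 12 25) (Seq (Add 12 12 1) (Seq (Add 24 9 2)
    (Seq (For 26 25 emit) (Seq (Write 4 9 1) (Add 11 11 1))))).

Definition route :=
  Seq (Read 17 4 9) (If 17 skip
    (Seq (Read 10 1 9) (Seq bfs (Seq (Read 25 5 9) (If 25 emit_path skip))))).

Definition phase := Seq (Add 5 5 4) (For 9 0 route).

Definition times (m x y : nat) :=
  Seq (Const 27 m) (Seq (Const y 0) (For 28 27 (Add y y x))).

(** Repeated doubling until [x] is reached, which yields the binary logarithm rounded up. *)
Definition log2 (x y : nat) :=
  Seq (Const 29 1) (Seq (Const y 0) (Seq (Sub 17 x 29)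
    (While 17 (Seq (Add 29 29 29) (Seq (Add y y 1) (Sub 17 x 29)))))).

(** Registers 31, 3, 32, 4, 33 and 34 receive log n, L, L + 1, 36 (L + 1), log log n and the number
    of phases. Output starts at position 1; position 0 is filled at the end with the number of
    paths. *)
Definition greedy_routing (m : nat) :=
  Seq (Const 1 1) (Seq (log2 0 31) (Seq (times 10 31 3) (Seq (Add 32 3 1)
    (Seq (times 36 32 4) (Seq (For 28 0 (Add 20 20 0)) (Seq (log2 31 33)
      (Seq (times m 33 34) (Seq (Const 12 1) (Seq (For 8 34 phase)
        (Write 2 2 11)))))))))).

Lemma reg_set_reg s x k y :
  reg (set_reg s x k) y = if y == x then k else reg s y.
Proof. by []. Qed.

Lemma arr_set_arr s a i k b :
  arr (set_arr s a i k) b = if b == a then update (arr s a) i k else arr s b.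
Proof. by []. Qed.

Lemma reg_set_arr s a i k x : reg (set_arr s a i k) x = reg s x.
Proof. by []. Qed.

Lemma arr_set_reg s x k a : arr (set_reg s x k) a = arr s a.
Proof. by []. Qed.

Definition memE := (reg_set_reg, arr_set_arr, reg_set_arr, arr_set_reg).

(** * Correctness of the search, of the output and of the phases *)

Section GreedyRouting.
Variables (n : nat) (G : sgraph n) (pi : {perm 'I_n}) (L B : nat).
Hypotheses (nB : n <= B) (LB : L < B).

Definition context (s : memory) :=
  [/\ reg s 0 = n, reg s 1 = 1, reg s 2 = 0, reg s 3 = L & reg s 20 = n * n] /\
  (forall x y : 'I_n, arr s 0 (x * n + y) = G x y) /\
  (forall x : 'I_n, arr s 1 x = pi x).

Lemma context_frame s s' : context s ->
  (forall x, x \in [:: 0; 1; 2; 3; 20] -> reg s' x = reg s x) ->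
  arr s' 0 = arr s 0 -> arr s' 1 = arr s 1 -> context s'.
Proof.
case=> [[h0 h1 h2 h3 h20] [ha hp]] hr a0 a1.
by rewrite /context a0 a1 !hr.
Qed.

Section Search.
Variables (A : {set 'I_n}) (v : 'I_n).

Lemma wp_relax_row s j x : context s -> reg s 14 = x -> reg s 22 = j.+1 ->
  reg s 16 = x.+1 * n ->
  (forall y : 'I_n, (y \in A) = (arr s 3 y < reg s 5)) -> x < n ->
  round_inv G A v j (fun a _ => x < a) (arr s 5) (arr s 6) ->
  wp B (For 15 0 relax) (fun s' => reg s' 16 = x * n /\
    round_inv G A v j (fun a _ => x <= a) (arr s' 5) (arr s' 6)) s.
Proof.
move=> cs s14 s22 s16 HA xn H0; have [[h0 h1 h2 h3 h20] [ha hp]] := cs.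
(* The treated pairs are those of higher rows and those of row [x] from column [k] on. *)
pose I k s' := reg s' 16 = x * n + k /\
  round_inv G A v j (fun a b => (x < a) || (a == x) && (k <= b)) (arr s' 5) (arr s' 6).
apply: (@wp_for _ _ _ _ I) => //; rewrite ?h0 //.
- split; first by rewrite !memE /= s16 mulSn addnC.
  apply: round_inv_sub H0 _ => a b; rewrite [n <= b]leqNgt ltn_ord andbF orbF //.
- move=> k s' kn [I16 Ir] hr har.
  have [r14 r22 r5 r1] : [/\ reg s' 14 = x, reg s' 22 = j.+1, reg s' 5 = reg s 5 & reg s' 1 = 1].
    by rewrite !hr.
  have a0 := har 0 isT; have a3 := har 3 isT.
  pose X := Ordinal xn; pose K := Ordinal kn.
  have keep : ~ [/\ G X K, arr s' 5 x = 0, 0 < arr s' 5 k <= j.+1 & X \in A] ->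
     round_inv G A v j (fun a b => (x < a) || (a == x) && (k <= b)) (arr s' 5) (arr s' 6).
    move=> H; apply: round_inv_sub (round_inv_keep Ir H) _ => a b /=.
    lia.
  (* Each failing test refutes one of the conditions for an update, so skipping the pair is
     sound. *)
  have stop s'' : reg s'' 16 = x * n + k -> arr s'' 5 = arr s' 5 ->
      arr s'' 6 = arr s' 6 ->
      ~ [/\ G X K, arr s' 5 x = 0, 0 < arr s' 5 k <= j.+1 & X \in A] ->
      wp B skip (I k) s''.
    by move=> e16 e5 e6 H; apply: wp_const; split; rewrite !memE /= ?e5 ?e6 //; apply: keep.
  have aXK : arr s 0 (x * n + k) = G X K by rewrite -ha.
  do 2 (apply: wp_seq; first [apply: wp_sub|apply: wp_read]).
  rewrite !memE /= r1 I16 subn1 addnS /= a0 aXK.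
  apply: wp_if; rewrite !memE /= => GXK; last first.
    by apply: stop => //; case; case: (G X K) GXK.
  have {}GXK : G X K by case: (G X K) GXK.
  apply: wp_seq; apply: wp_read; rewrite !memE /= r14.
  apply: wp_if; rewrite !memE /= => Dx; first by apply: stop => //; case.
  apply: wp_seq; apply: wp_read; rewrite !memE /=.
  apply: wp_if; rewrite !memE /= => Dk; last by apply: stop => //; case=> _ _; rewrite Dk.
  apply: wp_seq; apply: wp_sub; rewrite !memE /= r22.
  apply: wp_if; rewrite !memE /= => Dj.
    by apply: stop => //; case=> _ _ /andP[_ h] _; apply: Dj; apply/eqP; rewrite subn_eq0.
  apply: wp_seq; apply: wp_read; rewrite !memE /= r14.
  apply: wp_seq; apply: wp_sub; rewrite !memE /= r5 a3.
  apply: wp_if; rewrite !memE /= => xA; last first.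
    apply: stop => //; case=> _ _ _; rewrite HA /= ltnNge -subn_eq0.
    by rewrite xA.
  apply: wp_seq; apply: wp_add; rewrite !memE /= r1 addn1.
  apply: wp_seq; apply: wp_write; rewrite !memE /= r14.
  apply: wp_write; split; rewrite !memE //= r14.
  have XA : X \in A by rewrite HA /= ltnNge -subn_eq0; apply/eqP.
  have Dkj : 0 < arr s' 5 K <= j.+1.
    by rewrite lt0n -[_ <= _]subn_eq0 Dj eqxx andbT; apply/eqP.
  apply: round_inv_sub (round_inv_set Ir GXK Dx Dkj XA) _ => a b /=.
  lia.
move=> s' [I16 Ir] hr har; rewrite I16 addn0; split=> //.
apply: round_inv_sub Ir _ => a b; rewrite leq_eqVlt eq_sym andbT orbC //.
Qed.

Lemma wp_round s j : context s -> reg s 13 = L - j.+1 -> j < L ->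
  (forall y : 'I_n, (y \in A) = (arr s 3 y < reg s 5)) ->
  bfs_inv G A v j (arr s 5) (arr s 6) ->
  wp B round (fun s' => bfs_inv G A v j.+1 (arr s' 5) (arr s' 6)) s.
Proof.
move=> cs s13 jL HA H0; have [[h0 h1 h2 h3 h20] [ha hp]] := cs.
apply: wp_seq; apply: wp_sub; apply: wp_seq; apply: wp_add; rewrite !memE /=.
rewrite h3 s13 subKn // h20 h2 addn0; set s1 := set_reg _ 16 _.
have cs1 : context s1.
  apply: context_frame cs _ _ _ => // x.
  by rewrite !inE => /or4P[|||/orP[]] /eqP->.
pose I k s' := reg s' 16 = k * n /\
  round_inv G A v j (fun a _ => k <= a) (arr s' 5) (arr s' 6).
apply: (@wp_for _ _ _ _ I) => //.
- by rewrite !memE /= h0.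
- rewrite !memE /= h0; split=> //.
  by apply: round_inv_sub (round_inv_start H0) _ => a b; rewrite leqNgt ltn_ord.
- rewrite !memE /= h0 => k s' kn [I16 Ir] hr har.
  apply: wp_relax_row; rewrite ?memE //=.
  + apply: context_frame cs1 _ _ _; rewrite ?memE ?har //.
    move=> x; rewrite !inE => /or4P[|||/orP[]] /eqP->; rewrite !memE /= hr //.
  + by rewrite hr.
  + by move=> y; rewrite HA har // hr.
move=> s' [_ Ir] _ _; apply: round_inv_end; exact: round_inv_sub Ir _.
Qed.

Lemma wp_bfs s : context s -> reg s 10 = v ->
  (forall y : 'I_n, (y \in A) = (arr s 3 y < reg s 5)) ->
  wp B bfs (fun s' => bfs_inv G A v L (arr s' 5) (arr s' 6)) s.
Proof.
move=> cs s10 HA; have [[h0 h1 h2 h3 h20] [ha hp]] := cs.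
apply: wp_seq.
pose I k s' := forall x : 'I_n, k <= x -> arr s' 5 x = 0.
apply: (@wp_for _ _ _ _ I) => //; rewrite ?h0 //.
- by move=> x; rewrite leqNgt ltn_ord.
- move=> k s' kn Ik hr har; apply: wp_write => x kx; rewrite !memE /= /update.
  case: eqP => [_|ne]; first by rewrite hr.
  by apply: Ik; rewrite ltn_neqAle kx andbT; apply/eqP => e; apply: ne.
move=> s' I0 hr har.
have cs' : context s'.
  apply: context_frame cs _ _ _; rewrite ?har //.
  by move=> x; rewrite !inE => /or4P[|||/orP[]] /eqP->; rewrite hr.
have HA' y : (y \in A) = (arr s' 3 y < reg s' 5) by rewrite HA har // hr.
have s10' : reg s' 10 = v by rewrite hr.
move: s' cs' HA' s10' I0 {hr har cs s10 HA h0 h1 h2 h3 h20 ha hp} => {}s cs HA s10 D0.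
have [[h0 h1 h2 h3 h20] [ha hp]] := cs.
apply: wp_seq.
have base s' : (forall y : 'I_n, arr s' 5 y = ((y == v) && (v \in A))) ->
    bfs_inv G A v 0 (arr s' 5) (arr s' 6).
  move=> HD; split=> x; rewrite HD.
  - case: eqP => //= ->; case: (boolP (v \in A)) => // vA _.
    by split=> //; left.
  - by case: (_ && _).
  by rewrite !inE andbC => /andP[/eqP->]; rewrite eqxx => ->.
have : wp B start (fun s' => forall y : 'I_n, arr s' 5 y = ((y == v) && (v \in A))) s.
  apply: wp_seq; apply: wp_read; apply: wp_seq; apply: wp_sub.
  rewrite !memE /= s10.
  apply: wp_if; rewrite !memE /= => vA.
    apply: wp_write => y; rewrite !memE /= s10 h1 /update.
    have -> : v \in A by rewrite HA ltnNge -subn_eq0; apply/eqP.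
    by rewrite andbT val_eqE; case: eqP => // _; rewrite D0.
  apply: wp_const => y; rewrite !memE D0 //.
  have -> : v \in A = false by rewrite HA ltnNge -subn_eq0 vA.
  by rewrite andbF.
move/wp_conseq; apply => s' hr har /base H0.
have cs' : context s'.
  apply: context_frame cs _ _ _; rewrite ?har //.
  by move=> x; rewrite !inE => /or4P[|||/orP[]] /eqP->; rewrite hr.
have HA' y : (y \in A) = (arr s' 3 y < reg s' 5) by rewrite HA har // hr.
move: s' cs' HA' H0 {hr har cs s10 HA h0 h1 h2 h3 h20 ha hp D0 base} => {}s cs HA H0.
have [[h0 h1 h2 h3 h20] [ha hp]] := cs.
(* The counter descends from [L], so [L - k] rounds have been completed. *)
pose J k s' := k <= L /\ bfs_inv G A v (L - k) (arr s' 5) (arr s' 6).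
apply: (@wp_for _ _ _ _ J) => //.
- by rewrite h3 ltnW.
- by rewrite h3 /J subnn; split.
- rewrite h3 => k s' kL [_ Ik] hr har.
  have e : L - k = (L - k.+1).+1 by lia.
  have : wp B round (fun s'' => bfs_inv G A v (L - k.+1).+1 (arr s'' 5) (arr s'' 6)) (set_reg s' 13 k).
    apply: wp_round; rewrite ?memE //=; last 1 first.
    + by move=> y; rewrite HA har // hr.
    + apply: context_frame cs _ _ _; rewrite ?memE ?har //.
      by move=> x; rewrite !inE => /or4P[|||/orP[]] /eqP->; rewrite !memE /= hr.
    + by lia.
    + by lia.
  move/wp_conseq; apply => s'' _ _; rewrite -e => h; split=> //; exact: ltnW.
by move=> s' [_]; rewrite subn0.
Qed.
End Search.

(** Position 0 of the output is left out because the number of paths is written there only after the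
    last phase. *)
Definition represents (s : memory) (P : seq (seq 'I_n)) :=
  [/\ forall v : 'I_n, arr s 3 v = load P v,
      forall u : 'I_n, (arr s 4 u != 0) = (u \notin unrouted pi P),
      reg s 11 = size P, reg s 12 = size (encode_paths P)
    & forall i, 0 < i < size (encode_paths P) ->
        arr s 2 i = nth 0 (encode_paths P) i].

Lemma encode_paths_rcons (P : seq (seq 'I_n)) p i : 0 < i ->
  nth 0 (encode_paths (rcons P p)) i =
  nth 0 (encode_paths P ++ size p :: [seq nat_of_ord v | v <- p]) i.
Proof.
by case: i => // i _; rewrite /encode_paths map_rcons flatten_rcons.
Qed.

Lemma size_encode_paths_rcons (P : seq (seq 'I_n)) p :
  size (encode_paths (rcons P p)) = size (encode_paths P) + (size p).+1.
Proof. by rewrite /encode_paths /= map_rcons flatten_rcons size_cat /= size_map. Qed.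

Lemma wp_emit_loop s x p : context s ->
  path (fun a b : 'I_n => arr s 6 a == b) x p -> uniq (x :: p) ->
  (size p).+1 <= B -> reg s 24 = x -> reg s 25 = (size p).+1 ->
  wp B (For 26 25 emit) (fun s' =>
    [/\ reg s' 12 = reg s 12 + (size p).+1,
        forall v : 'I_n, arr s' 3 v = arr s 3 v + (v \in x :: p),
        forall i, i < reg s 12 -> arr s' 2 i = arr s 2 i
      & forall i, i <= size p ->
          arr s' 2 (reg s 12 + i) = nth 0 [seq nat_of_ord v | v <- x :: p] i]) s.
Proof.
move=> cs pp up pB s24 s25; have [[h0 h1 h2 h3 h20] [ha hp]] := cs.
set e := reg s 12; set q := (size p).+1 in pB s25 *.
have sq : size (x :: p) = q by [].
(* After [q - k] emitted vertices, register 24 holds the next one. The guard [0 < k] is there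
   because the pointer read at the last vertex is meaningless. *)
pose I k s' := [/\ k <= q, reg s' 12 = e + (q - k),
  0 < k -> reg s' 24 = nth x (x :: p) (q - k) &
  [/\ forall v : 'I_n, arr s' 3 v = arr s 3 v + (v \in take (q - k) (x :: p)),
        forall i, i < e -> arr s' 2 i = arr s 2 i
      & forall i, i < q - k ->
          arr s' 2 (e + i) = nth 0 [seq nat_of_ord v | v <- x :: p] i]].
apply: (@wp_for _ _ _ _ I); rewrite ?s25 //.
- rewrite /I subnn take0; split=> //; rewrite ?memE ?addn0 //=.
  by split=> // v; rewrite addn0.
- move=> k s' kq [_ I12 /(_ isT) I24 [I3 I2e I2]] hr har.
  have r1 : reg s' 1 = 1 by rewrite hr.
  have r6 : arr s' 6 = arr s 6 by rewrite har.
  set m := q - k.+1 in I12 I24 I3 I2.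
  have qk : q - k = m.+1 by rewrite /m; lia.
  have mq : m < q by rewrite /m; lia.
  set w := nth x (x :: p) m in I24.
  do 2 (apply: wp_seq; first [apply: wp_write|apply: wp_add]).
  apply: wp_seq; apply: wp_read; apply: wp_seq; apply: wp_add.
  apply: wp_seq; apply: wp_write; apply: wp_read.
  rewrite !memE /= r1 I12 I24 !addn1 r6; split; rewrite ?memE /=.
  + exact: ltnW.
  + by rewrite qk addnS.
  + move=> k0; rewrite qk.
    have mp : m < size p by move: k0 kq; rewrite /m /q; lia.
    by have /(pathP x) /(_ m mp) /eqP := pp.
  rewrite qk (take_nth x) -/w ?sq //; split.
  + move=> v; rewrite /update mem_rcons inE val_eqE.
    case: eqP => [->|_]; last exact: I3.
    (* The vertices are distinct, so [w] was not emitted before and its load rises by exactly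
       one. *)
    rewrite I3 addn1 (_ : w \in take m (x :: p) = false) ?addn0 //.
    have := up; rewrite -{1}(cat_take_drop m (x :: p)) cat_uniq => /and3P[_ /hasPn h _].
    apply/negbTE/h; rewrite (drop_nth x) ?sq // inE eqxx //.
  + by move=> i ie; rewrite /update ltn_eqF ?I2e // (leq_trans ie) ?leq_addr.
  move=> i; rewrite /update eqn_add2l ltnS leq_eqVlt.
  case: eqP => [-> _|_ /=]; last exact: I2.
  by rewrite -[_ :: _]/(map _ (x :: p)) (nth_map x) ?sq.
move=> s' [_ I12 _ [I3 I2e I2]] hr har; rewrite subn0 in I12 I3 I2; split=> //.
by move=> v; rewrite I3 take_oversize.
Qed.

Lemma wp_emit_path s P (x : 'I_n) p : context s -> represents s P -> reg s 9 = x ->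
  reg s 25 = (size p).+1 ->
  path (fun a b : 'I_n => arr s 6 a == b) x p -> uniq (x :: p) ->
  size p < B -> joins (x :: p) x (pi x) ->
  wp B emit_path (fun s' => represents s' (rcons P (x :: p))) s.
Proof.
move=> cs [R3 R4 R11 R12 R2] s9 s25 pp up pB jx.
have [[h0 h1 h2 h3 h20] [ha hp]] := cs.
do 3 (apply: wp_seq; first [apply: wp_write|apply: wp_add]).
apply: wp_seq; rewrite !memE /= h1 h2 s9 s25 R12 addn0 addn1.
set s1 := set_reg _ 24 _.
have cs1 : context s1.
  apply: context_frame cs _ _ _; rewrite ?memE // => y.
  by rewrite !inE => /or4P[|||/orP[]] /eqP->.
have := wp_emit_loop cs1 pp up pB (erefl _) s25.
move/wp_conseq; apply => s' hr har [E12 E3 E2e E2].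
apply: wp_seq; apply: wp_write; apply: wp_add; rewrite !memE /=.
have [r9 r1 r11] : [/\ reg s' 9 = x, reg s' 1 = 1 & reg s' 11 = size P].
  by rewrite !hr // !memE.
have a4 : arr s' 4 = arr s 4 by rewrite har.
rewrite r9 r1 r11 addn1; split; rewrite ?memE /=.
- by move=> v; rewrite E3 load_rcons -R3.
(* The new path starts at [x], so it can only route [x], matching the single flag that is set. *)
- move=> u; rewrite /update unrouted_rcons inE a4 val_eqE negb_and negbK inE.
  case: (eqVneq u x) => [->|ux]; first by rewrite jx.
  rewrite R4 /joins /= (_ : Some x == Some u = false) //.
  by apply: contraNF ux => /eqP[->].
- by rewrite size_rcons.
- by have := size_encode_paths_rcons P (x :: p); rewrite E12 /= /update /= => ->; lia.
move=> i /andP[i0 ie].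
have {}ie : i < size (encode_paths (rcons P (x :: p))) by [].
rewrite size_encode_paths_rcons in ie.
rewrite encode_paths_rcons // nth_cat.
case: ltnP => iP.
  have iP' : i < reg s1 12 by apply: ltnW; rewrite ltnS.
  rewrite E2e //= /update /= ltn_eqF // R2 //.
  by rewrite i0.
have [->|ne] := eqVneq i (size (encode_paths P)).
  have eP : size (encode_paths P) < reg s1 12 by [].
  by rewrite subnn (E2e _ eP) /= /update /= eqxx.
have [m im] : exists m, i = (size (encode_paths P)).+1 + m.
  by exists (i - (size (encode_paths P)).+1); move: iP ne; lia.
rewrite im in ie *.
have mp : m <= size p by move: ie; rewrite addSnnS ltn_add2l.
apply: etrans (E2 m mp) _; by rewrite addSnnS addKn.
Qed.

Lemma represents_frame s s' P : represents s P ->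
  reg s' 11 = reg s 11 -> reg s' 12 = reg s 12 ->
  arr s' 2 = arr s 2 -> arr s' 3 = arr s 3 -> arr s' 4 = arr s 4 ->
  represents s' P.
Proof. by rewrite /represents => -[? ? ? ? ?] -> -> -> -> ->. Qed.

Lemma wp_route s T P0 P (u : 'I_n) : context s -> represents s P ->
  reg s 5 = T -> reg s 9 = u -> phase_inv G pi L T P0 u.+1 P ->
  wp B route (fun s' => exists2 P', represents s' P' &
    phase_inv G pi L T P0 u P') s.
Proof.
move=> cs rs s5 s9 ph; have [[h0 h1 h2 h3 h20] [ha hp]] := cs.
have [R3 R4 R11 R12 R2] := rs.
have stop s' : reg s' 11 = reg s 11 -> reg s' 12 = reg s 12 ->
    arr s' 2 = arr s 2 -> arr s' 3 = arr s 3 -> arr s' 4 = arr s 4 ->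
    phase_inv G pi L T P0 u P ->
    wp B skip (fun s' => exists2 P', represents s' P' & phase_inv G pi L T P0 u P') s'.
  by move=> *; apply: wp_const; exists P => //; apply: represents_frame rs _ _ _ _ _.
apply: wp_seq; apply: wp_read; rewrite s9.
apply: wp_if; rewrite !memE /= => r4.
  by apply: stop => //; apply: phase_inv_routed ph _; rewrite -R4; apply/eqP.
have uP : u \in unrouted pi P by rewrite -[_ \in _]negbK -R4 r4.
apply: wp_seq; apply: wp_read; rewrite !memE /= s9 hp.
apply: wp_seq; set s1 := set_reg _ 10 _.
have cs1 : context s1.
  apply: context_frame cs _ _ _ => // x.
  by rewrite !inE => /or4P[|||/orP[]] /eqP->.
have HA (y : 'I_n) : (y \in allowed P T) = (arr s1 3 y < reg s1 5).
  by rewrite inE -R3 -s5.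
have s10 : reg s1 10 = pi u by [].
have := wp_bfs cs1 s10 HA.
move/wp_conseq; apply => s2 hr har [lab le bal].
have cs2 : context s2.
  apply: context_frame cs1 _ _ _; rewrite ?har // => x.
  by rewrite !inE => /or4P[|||/orP[]] /eqP->; rewrite hr.
have rs2 : represents s2 P by apply: represents_frame rs _ _ _ _ _; rewrite ?hr ?har.
have s29 : reg s2 9 = u by rewrite hr.
apply: wp_seq; apply: wp_read; rewrite s29.
apply: wp_if; rewrite !memE /= => Du; last first.
  apply: stop; rewrite ?memE /=; do ?[by rewrite hr | by rewrite har].
  by apply: phase_inv_unreachable ph _; apply/negP => /bal.
have [q Dq] : exists q, arr s2 5 u = q.+1.
  by case: (arr s2 5 u) Du => // q _; exists q.
have qL : q <= L by rewrite -ltnS -Dq.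
have [p [pp lp sp up Dp]] := labels_path lab Dq.
have jp : joins (u :: p) u (pi u).
  by rewrite /joins /= eqxx (lastI u p) rev_rcons /= lp eqxx.
have gp : good_path G L (u :: p).
  rewrite /good_path /is_path up /= sp ltnS qL !andbT.
  by apply: sub_path pp => a b /andP[].
have pA : {subset u :: p <= allowed P T}.
  by move=> y /Dp /andP[Dy _]; have [|//] := lab y; apply/eqP; rewrite -lt0n.
have {pp}pp : path (fun a b : 'I_n => arr s2 6 a == b) u p.
  by apply: sub_path pp => a b /andP[].
set s3 := set_reg _ 25 _.
have cs3 : context s3.
  apply: context_frame cs2 _ _ _ => // x.
  by rewrite !inE => /or4P[|||/orP[]] /eqP->.
have rs3 : represents s3 P by apply: represents_frame rs2 _ _ _ _ _.
have s25 : reg s3 25 = (size p).+1 by rewrite sp -Dq.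
have pB : size p < B by rewrite sp (leq_ltn_trans qL).
have := wp_emit_path cs3 rs3 s29 s25 pp up pB jp.
move/wp_conseq; apply => s4 _ _ rs4; exists (rcons P (u :: p)) => //.
exact: phase_inv_rcons ph uP gp jp pA.
Qed.

Lemma wp_phase s P : context s -> represents s P ->
  (forall v, load P v <= reg s 5) ->
  wp B phase (fun s' => reg s' 5 = reg s 5 + reg s 4 /\
    exists2 P', represents s' P' &
      phase_inv G pi L (reg s 5 + reg s 4) P 0 P') s.
Proof.
move=> cs rs HT; have [[h0 h1 h2 h3 h20] [ha hp]] := cs.
apply: wp_seq; apply: wp_add; set T := reg s 5 + reg s 4.
pose I k s' := exists2 P', represents s' P' & phase_inv G pi L T P k P'.
apply: (@wp_for _ _ _ _ I) => //; rewrite ?memE /= ?h0 //.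
- exists P; [exact: represents_frame rs _ _ _ _ _ | exact: phase_inv0].
- move=> k s' kn [P' rs' ph] hr har.
  have cs' : context (set_reg s' 9 k).
    apply: context_frame cs _ _ _; rewrite ?memE ?har // => x.
    by rewrite !inE => /or4P[|||/orP[]] /eqP->; rewrite !memE /= hr.
  by apply: (@wp_route _ T P P' (Ordinal kn)) => //; rewrite !memE /= hr.
by move=> s' I0 hr har; split=> //; rewrite hr.
Qed.

Lemma wp_phases s J : context s -> represents s [::] -> reg s 5 = 0 ->
  reg s 34 = J -> J <= B -> reg s 4 = 36 * L.+1 -> L = 10 * up_log 2 n ->
  (forall X : {set 'I_n}, 3 * #|X| <= 2 * n -> #|X| <= 3 * #|nbhd G X :\: X|) ->
  wp B (For 8 34 phase) (fun s' => exists P, [/\ represents s' P,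
    all (good_path G L) P, forall v, load P v <= J * (36 * L.+1) &
    #|unrouted pi P| * 2 ^ J <= n]) s.
Proof.
move=> cs rs s5 s34 JB s4 LL expansion; set K := 36 * L.+1 in s4 *.
have [[h0 h1 h2 h3 h20] [ha hp]] := cs.
pose I k s' := [/\ k <= J, reg s' 5 = (J - k) * K & exists P,
    [/\ represents s' P, all (good_path G L) P,
    forall v, load P v <= (J - k) * K & #|unrouted pi P| * 2 ^ (J - k) <= n]].
apply: (@wp_for _ _ _ _ I) => //; rewrite ?s34 //.
- rewrite /I subnn; split=> //; exists [::]; split=> //.
  by rewrite muln1 -[leqRHS]card_ord max_card.
- move=> k s' kJ [_ I5 [P [rP gP lP uP]]] hr har.
  have cs' : context (set_reg s' 8 k).
    apply: context_frame cs _ _ _; rewrite ?memE ?har // => x.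
    by rewrite !inE => /or4P[|||/orP[]] /eqP->; rewrite !memE /= hr.
  have rP' : represents (set_reg s' 8 k) P by apply: represents_frame rP _ _ _ _ _.
  have lP' v : load P v <= reg (set_reg s' 8 k) 5 by rewrite !memE /= I5.
  have := wp_phase cs' rP' lP'; rewrite !memE /= I5 [reg s' 4]hr // s4.
  have e : J - k = (J - k.+1).+1 by lia.
  have eK : (J - k.+1) * K + K = (J - k) * K by rewrite e mulSn addnC.
  move/wp_conseq; apply => s'' _ _ [r5 [P' rP2 ph]].
  have half := phase_halves expansion LL lP ph.
  case: ph => [[Q PQ [gQ _]] lP2 _]; split; rewrite -?eK //; first exact: ltnW.
  exists P'; split=> //; first by rewrite PQ all_cat gP.
  apply: leq_trans uP; rewrite e expnS mulnA [_ * 2]mulnC.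
  by rewrite leq_mul2r half orbT.
by move=> s' [_ _ [P]]; rewrite subn0 => h _ _; exists P.
Qed.
End GreedyRouting.

(** * Arithmetic subroutines, input encoding and the whole program *)

Lemma wp_times B m x y s : reg s 1 = 1 -> reg s 2 = 0 -> m <= B ->
  x \notin [:: y; 27; 28] -> y \notin [:: 1; 2; 27; 28] ->
  wp B (times m x y) (fun s' => reg s' y = m * reg s x) s.
Proof.
move=> h1 h2 mB; rewrite !inE !negb_or => /and3P[xy x27 x28] /and4P[y1 y2 y27 y28].
have [yx y1' y2' y27' y28'] :
  [/\ (y == x) = false, (1 == y) = false, (2 == y) = false, (27 == y) = false
     & (28 == y) = false].
  by rewrite ![_ == y]eq_sym [y == x]eq_sym; split; apply/negbTE.
apply: wp_seq; apply: wp_const; apply: wp_seq; apply: wp_const.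
pose I k s' := k <= m /\ reg s' y = (m - k) * reg s x.
apply: (@wp_for _ _ _ _ I); rewrite ?memE /= ?y1' ?y2' ?y27' //.
- by rewrite inE y1'.
- by rewrite inE y28'.
- by rewrite /I /= /update subnn (negbTE y28) eqxx.
- move=> k s' km [_ Iy] hr har; apply: wp_add; split; first exact: ltnW.
  have rx : reg s' x = reg s x.
    by rewrite hr ?inE // /= /update (negbTE xy) (negbTE x27).
  rewrite /= /update eqxx (negbTE y28) (negbTE x28) Iy rx -mulSnr.
  by congr (_ * _); lia.
by move=> s' [_ ->]; rewrite subn0.
Qed.

Lemma wp_log2 B x y s : reg s 1 = 1 -> up_log 2 (reg s x) <= B ->
  x \notin [:: y; 17; 29] -> y \notin [:: 1; 17; 29] ->
  wp B (log2 x y) (fun s' => reg s' y = up_log 2 (reg s x)) s.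
Proof.
move=> h1 NB; rewrite !inE !negb_or => /and3P[xy x17 x29] /and3P[y1 y17 y29].
have [yx y1' y17' y29'] :
  [/\ (y == x) = false, (1 == y) = false, (17 == y) = false & (29 == y) = false].
  by rewrite ![_ == y]eq_sym [y == x]eq_sym; split; apply/negbTE.
set N := reg s x in NB *.
apply: wp_seq; apply: wp_const; apply: wp_seq; apply: wp_const.
apply: wp_seq; apply: wp_sub.
pose I k s' := exists l, [/\ l + k = up_log 2 N, reg s' y = l, reg s' 29 = 2 ^ l,
  reg s' 17 = N - 2 ^ l & reg s' x = N /\ reg s' 1 = 1].
have Nup : N <= 2 ^ up_log 2 N by apply: up_logP.
apply: (@wp_while _ _ _ I (up_log 2 N)) => //.
- exists 0; rewrite !memE /= ?y1' ?y17' ?y29' ?(negbTE y17) ?(negbTE y29).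
  by rewrite (negbTE xy) (negbTE x17) (negbTE x29) eqxx; split.
- move=> k s' [l [lk -> r29 r17 _]] s17; move: s17; rewrite r17 => /eqP.
  rewrite subn_eq0 => /(up_log_min (isT : 1 < 2)); lia.
move=> k s' [l [lk ry r29 r17 [rx r1]]] s17.
case: k lk => [|k] lk.
  by case: s17; rewrite r17; apply/eqP; rewrite subn_eq0 -[l]addn0 lk.
exists k => //; apply: wp_seq; apply: wp_add; apply: wp_seq; apply: wp_add; apply: wp_sub.
exists l.+1; rewrite !memE /= ?y1' ?y17' ?y29' ?(negbTE y17) ?(negbTE y29).
rewrite (negbTE xy) (negbTE x17) (negbTE x29) eqxx ry r29 rx r1.
by rewrite expnS mul2n -addnn addSnnS addn1; split.
Qed.

Lemma nth_allpairs (S T U : Type) (f : S -> T -> U) x0 y0 z0 s t i j :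
  i < size s -> j < size t ->
  nth z0 [seq f x y | x <- s, y <- t] (i * size t + j) =
  f (nth x0 s i) (nth y0 t j).
Proof.
elim: s i => // x s IH [|i] /= si tj; rewrite nth_cat size_map.
  by rewrite mul0n add0n tj (nth_map y0).
by rewrite mulSn -addnA ltnNge leq_addr /= addKn IH.
Qed.

Lemma input_adjacency n (G : sgraph n) pi (x y : 'I_n) :
  arr (input G pi) 0 (x * n + y) = G x y.
Proof.
rewrite /= /update /= /memory_of_seq.
have := @nth_allpairs _ _ _ (fun u v => nat_of_bool (G u v)) x x 0 (enum 'I_n)
  (enum 'I_n) x y.
by rewrite size_enum_ord !nth_ord_enum => ->.
Qed.

Lemma input_permutation n (G : sgraph n) pi (x : 'I_n) :
  arr (input G pi) 1 x = pi x.
Proof.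
rewrite /= /update /= /memory_of_seq (nth_map x) ?size_enum_ord //.
by rewrite nth_ord_enum.
Qed.

Lemma up_log2_leq n : up_log 2 n <= n.
Proof. by apply: up_log_min => //; apply/ltnW/ltn_expl. Qed.

Lemma wp_greedy_routing n (G : sgraph n) pi m
    (L := 10 * up_log 2 n) (J := m * up_log 2 (up_log 2 n)) : 2 <= n ->
  (forall X : {set 'I_n}, 3 * #|X| <= 2 * n -> #|X| <= 3 * #|nbhd G X :\: X|) ->
  wp ((m + 36) * n) (greedy_routing m) (fun s' => exists P,
    [/\ outputs s' P, all (good_path G L) P,
      forall v, load P v <= J * (36 * L.+1) &
      #|unrouted pi P| * 2 ^ J <= n]) (input G pi).
Proof.
move=> n2 expansion; set B := (m + 36) * n; set s0 := input G pi.
have ln := up_log2_leq n; have lln := up_log2_leq (up_log 2 n).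
(* One bound [B] serves all loops: [n], path lengths, phases and the constants [m] and 36. *)
have [nB LB JB] : [/\ n <= B, L < B & J <= B].
  by split; rewrite /B /L /J; nia.
have [mB B36] : m <= B /\ 36 <= B by split; rewrite /B; nia.
apply: wp_seq; apply: wp_const; set s1 := set_reg _ 1 1.
have lB : up_log 2 (reg s1 0) <= B by apply: leq_trans nB.
apply: wp_seq; have := @wp_log2 B 0 31 s1 erefl lB isT isT.
move/wp_conseq; apply => s2 hr2 ha2; rewrite -[reg s1 0]/n => s31.
have [h21 h22] : reg s2 1 = 1 /\ reg s2 2 = 0 by rewrite !hr2.
apply: wp_seq.
have := @wp_times B 10 31 3 s2 h21 h22 (leq_trans (isT : 10 <= 36) B36) isT isT.
move/wp_conseq; apply => s3 hr3 ha3; rewrite s31 -/L => s3L.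
apply: wp_seq; apply: wp_add; rewrite s3L [reg s3 1]hr3 // hr2 // addn1.
set s4 := set_reg _ 32 _.
have [h41 h42] : reg s4 1 = 1 /\ reg s4 2 = 0.
  by rewrite /s4 !memE /= !hr3 // !hr2.
apply: wp_seq; have := @wp_times B 36 32 4 s4 h41 h42 B36 isT isT.
move/wp_conseq; apply => s5 hr5 ha5; rewrite -[reg s4 32]/(L.+1) => s54.
apply: wp_seq.
have [h50 h51 h52 h520] : [/\ reg s5 0 = n, reg s5 1 = 1, reg s5 2 = 0 & reg s5 20 = 0].
  by rewrite !hr5 // /s4 !memE /= !hr3 // !hr2.
pose I k s' := k <= n /\ reg s' 20 = (n - k) * n.
apply: (@wp_for _ _ _ _ I) => //; rewrite ?h50 //.
- by rewrite /I !memE /= subnn.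
- move=> k s' kn [_ I20] hr _; apply: wp_add; split; first exact: ltnW.
  by rewrite !memE /= I20 hr // h50 -mulSnr; congr (_ * _); lia.
move=> s6 [_ +] hr6 ha6; rewrite subn0 => s620.
have [h631 h61] : reg s6 31 = up_log 2 n /\ reg s6 1 = 1.
  by rewrite !hr6 // !hr5 // /s4 !memE /= !hr3 // hr2.
apply: wp_seq; have := @wp_log2 B 31 33 s6 h61; rewrite h631.
move=> /(_ (leq_trans lln (leq_trans ln nB)) isT isT).
move/wp_conseq; apply => s7 hr7 ha7 s733.
have [h71 h72] : reg s7 1 = 1 /\ reg s7 2 = 0 by rewrite !hr7 // !hr6.
apply: wp_seq; have := @wp_times B m 33 34 s7 h71 h72 mB isT isT.
move/wp_conseq; apply => s8 hr8 ha8; rewrite s733 -/J => s834.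
apply: wp_seq; apply: wp_const; set s9 := set_reg _ 12 _.
have arrs a : arr s9 a = arr s0 a.
  by rewrite /s9 memE ha8 // ha7 // ha6 // ha5 // /s4 memE ha3 // ha2.
have low x : x \in [:: 5; 11] -> reg s9 x = 0.
  by rewrite !inE => /orP[] /eqP->; rewrite /s9 !memE /= hr8 // hr7 // hr6 // hr5 //
    /s4 !memE /= hr3 // hr2.
have cs9 : context G pi L s9.
  split; last first.
    split; first by move=> x y; rewrite arrs; apply: input_adjacency.
    by move=> x; rewrite arrs; apply: input_permutation.
  rewrite /s9 !memE /= !hr8 // !hr7 //; split.
  - by rewrite hr6 // h50.
  - by rewrite hr6 // h51.
  - by rewrite hr6 // h52.
  - by rewrite hr6 // hr5 // /s4 !memE.
  exact: s620.
have rs9 : represents pi s9 [::].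
  split; rewrite ?arrs //; first by move=> u; rewrite inE.
  - exact: low.
  by case=> // i; rewrite /= ltnS ltn0 andbF.
have h94 : reg s9 4 = 36 * L.+1 by rewrite /s9 !memE /= hr8 // hr7 // hr6.
apply: wp_seq; have := wp_phases nB LB cs9 rs9 (low 5 isT) s834 JB h94 erefl expansion.
move/wp_conseq; apply => s' hr ha [P [[R3 R4 R11 R12 R2] gP lP uP]].
apply: wp_write; exists P; split=> // i iP.
have h2 : reg s' 2 = 0 by rewrite hr // /s9 !memE /= !hr8.
rewrite !memE /= h2 R11 /update; case: eqP => [->|/eqP i0] //.
by apply: R2; rewrite lt0n i0.
Qed.

(** * Asymptotics *)

(** With positive degree the edges cover all vertices, two at most by each; this converts bounds in
    [n] into bounds in the number of edges. *)
Lemma leq_double_edges n d (G : sgraph n) : 0 < d -> regular G d ->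
  n <= 2 * #|edges G|.
Proof.
move=> d0 Gd.
have cov : n = #|cover (edges G)|.
  rewrite -[LHS]card_ord -cardsT; congr #|pred_of_set _|; apply/setP => u.
  rewrite in_setT; apply/esym/bigcupP.
  have /card_gt0P[v] : 0 < #|[set v | G u v]| by rewrite Gd.
  rewrite inE => uv; exists [set u; v]; last by rewrite !inE eqxx.
  by apply/imsetP; exists (u, v); rewrite ?inE.
rewrite [leqLHS]cov; apply: leq_trans (leq_card_cover _) _.
rewrite mulnC -sum_nat_const; apply: leq_sum => e /imsetP[[u v] _ ->] /=.
by rewrite cards2; case: (u != v).
Qed.

(** Since [B.+1] is at most [2 * (m + 37)] times the number of edges, [cost_poly] gives the bound;
    [k] is large enough to serve both as factor and as exponent. *)
Lemma cost_edges n d (G : sgraph n) m c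
    (k := prog_size c * (2 * (m + 37)) ^ prog_size c) :
  0 < n -> 0 < d -> regular G d ->
  cost ((m + 36) * n) c <= k * #|edges G| ^ k.
Proof.
move=> n0 d0 Gd; apply: leq_trans (cost_poly _ _) _.
have nE := leq_double_edges d0 Gd.
have E0 : 0 < #|edges G| by lia.
rewrite /k -mulnA leq_mul2l; apply/orP; right.
set S := prog_size c.
apply: (@leq_trans (((2 * (m + 37)) * #|edges G|) ^ S)).
  by case: (S) => // S'; rewrite leq_exp2r //; nia.
rewrite expnMn leq_mul2l; apply/orP; right; apply: leq_pexp2l => //.
by rewrite -{1}[S]muln1 leq_mul2l expn_gt0 orbC; lia.
Qed.

Local Open Scope ring_scope.

Section Asymptotics.
Variable R : realType.

Lemma ln2_gt0 : 0 < ln 2 :> R.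
Proof. by rewrite ln_gt0 // ltr1n. Qed.

Lemma ln_le (x : R) : 0 < x -> ln x <= x.
Proof.
move=> x0; have := @le_ln1Dx R (x - 1); rewrite addrCA subrr addr0 ltrBrDl subrr.
by move=> /(_ x0) /le_trans; apply; lra.
Qed.

(** Rounding up adds less than 1, and 1 is at most the binary logarithm of [n]; hence the factor
    2. *)
Lemma up_log_le_ln (n : nat) : (2 <= n)%N ->
  (up_log 2 n)%:R <= 2 / ln 2 * ln n%:R :> R.
Proof.
move=> n2; have := up_log_gtn (isT : (1 < 2)%N) n2.
have : (0 < up_log 2 n)%N by rewrite up_log_gt0.
case: (up_log 2 n) => // l _ /= h.
have {}h : l%:R * ln 2 <= ln n%:R :> R.
  by rewrite mulr_natl -lnXn // ler_ln ?posrE ?exprn_gt0 ?ltr0n ?(ltn_trans _ n2) //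
    -natrX ler_nat ltnW.
have h2 : ln 2 <= ln n%:R :> R by rewrite ler_ln ?posrE ?ltr0n ?(ltn_trans _ n2) // ler_nat.
rewrite mulrAC ler_pdivlMr ?ln2_gt0 // -natr1 mulrDl; lra.
Qed.

Lemma ln_le_up_log (n : nat) : (0 < n)%N -> ln n%:R <= (up_log 2 n)%:R :> R.
Proof.
move=> n0; apply: (@le_trans _ _ (ln (2 ^+ up_log 2 n))).
  by rewrite ler_ln ?posrE ?exprn_gt0 ?ltr0n // -natrX ler_nat up_logP.
rewrite lnXn // -[leLHS]mulr_natl; apply: ler_piMr => //.
have /le_ln1Dx : -1 < 1 :> R by lra.
by rewrite -[1 + 1]/2.
Qed.

(** From ln (l^c) <= l^c follows ln l <= l^c / c; the summand 1 absorbs the rounding. With [l] of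
    order log n, this lets a factor log log n be absorbed into log^c n. *)
Lemma up_log_le_powR (l : nat) (c : R) : (0 < l)%N -> 0 < c ->
  (up_log 2 l)%:R <= (1 + (c * ln 2)^-1) * l%:R `^ c :> R.
Proof.
move=> l0 c0; have l1 : 1 <= l%:R :> R by rewrite ler1n.
have lp : 0 < l%:R :> R by rewrite ltr0n.
have lc1 : 1 <= l%:R `^ c :> R by rewrite -[leLHS](powRr0 l%:R) ler_powR // ltW.
have lnl : ln l%:R <= l%:R `^ c / c.
  by rewrite ler_pdivlMr // mulrC -ln_powR ln_le // powR_gt0.
have [l2|l2] := ltnP 1 l; last first.
  have -> : l = 1%N by apply/eqP; rewrite eqn_leq l2.
  by rewrite up_log1 mulr_ge0 ?powR_ge0 // addr_ge0 // invr_ge0 mulr_ge0 ?ltW ?ln2_gt0.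
have := up_log_gtn (isT : (1 < 2)%N) l2.
have : (0 < up_log 2 l)%N by rewrite up_log_gt0.
case: (up_log 2 l) => // k _ /= h.
have {}h : k%:R * ln 2 <= ln l%:R :> R.
  by rewrite mulr_natl -lnXn // ler_ln ?posrE ?exprn_gt0 // -natrX ler_nat ltnW.
have {}h : k%:R <= l%:R `^ c / c / ln 2 :> R.
  by rewrite ler_pdivlMr ?ln2_gt0 // (le_trans h).
by rewrite mulrDl mul1r -natr1 addrC lerD // (le_trans h) // invfM [leRHS]mulrC [leRHS]mulrA.
Qed.

End Asymptotics.

Theorem theorem3p3 (R : realType) :
  exists alpha : R, 0 < alpha /\
  forall c : R, 0 <= c ->
  exists (C : R) (k : nat) (algorithm : prog),
  forall (n d : nat) (G : sgraph n) (pi : {perm 'I_n}),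
    (2 <= n)%N -> (0 < d)%N -> regular G d ->
    sigma2 (normalized_adjacency R G d) <= alpha ->
  exists (t : nat) (s : memory) (P : seq (seq 'I_n)),
    [/\ runs algorithm (input G pi) t s,
        (t <= k * #|edges G| ^ k)%N
      & outputs s P] /\
    [/\ forall p, p \in P ->
          is_path G p /\ (path_length p)%:R <= C * ln n%:R,
        #|unrouted pi P|%:R / n%:R <= C / (ln n%:R `^ c)
      & forall v : 'I_n, (load P v)%:R <= C * ln n%:R `^ (c + 1)].
Proof.
exists (1 / 4); split; first by lra.
move=> c; rewrite le_eqVlt => /orP[/eqP<-|c0].
  (* For [c = 0] the allowed unrouted fraction is 1. Array 2 is all zeros, which already encodes the
     empty collection. *)
  exists 1, 1%N, (Const 0 0) => n d G pi n2 d0 Gd _.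
  exists 1%N, (set_reg (input G pi) 0 0), [::]; split.
    split; [exact: RunConst | | by case].
    by have := leq_double_edges d0 Gd; rewrite expn1 mul1n; lia.
  split=> // [|v]; last by rewrite mul1r powR_ge0.
  rewrite powRr0 divr1 ler_pdivrMr ?ltr0n ?(ltn_trans _ n2) // mul1r ler_nat.
  by rewrite -[leqRHS]card_ord max_card.
pose m := Num.bound c.
have cm : c <= m%:R by apply/ltW/archi_boundP/ltW.
pose a : R := 2 / ln 2; pose b : R := 1 + (c * ln 2)^-1.
have a0 : 0 <= a by rewrite divr_ge0 ?ltW ?ln2_gt0.
have b0 : 0 <= b by rewrite addr_ge0 // invr_ge0 mulr_ge0 ?ltW ?ln2_gt0.
(* The number of phases is at most m b (a x)^c, and each raises the loads by 36 (10 l + 1) <= 396 l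
   <= 396 a x, where x is ln n. *)
pose C2 := m%:R * b * a `^ c * 396 * a.
have C20 : 0 <= C2.
  by rewrite /C2; do 3![apply: mulr_ge0 => //]; [apply: mulr_ge0 | apply: powR_ge0].
pose g := greedy_routing m.
(* The three summands serve the unrouted fraction, the path lengths and the loads. *)
exists (1 + 10 * a + C2), (prog_size g * (2 * (m + 37)) ^ prog_size g)%N, g => n d G pi n2 d0 Gd sG.
have n0 : (0 < n)%N by apply: ltn_trans n2.
have expansion X := tanner_expansion (X := X) d0 Gd sG.
have [t [s [rn tc [P [oP gP lP uP]]]]] := wp_greedy_routing pi m n2 expansion.
exists t, s, P; split.
  by split=> //; apply: leq_trans tc (cost_edges _ _ n0 d0 Gd).
set l := up_log 2 n in gP lP uP; set x : R := ln n%:R.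
have l0 : (0 < l)%N by rewrite up_log_gt0.
have x0 : 0 < x by rewrite ln_gt0 // ltr1n.
have lx : l%:R <= a * x by apply: up_log_le_ln.
have xl : x <= l%:R by apply: ln_le_up_log.
have l1 : 1 <= l%:R :> R by rewrite ler1n.
split.
- move=> p /(allP gP) /andP[pp sp]; split=> //.
  apply: (@le_trans _ _ (10 * (a * x))).
    apply: le_trans (ler_wpM2l _ lx) => //.
    by rewrite -natrM ler_nat /path_length; case: (size p) sp.
  by rewrite mulrA ler_pM2r //; lra.
- have xc : 0 < x `^ c by apply: powR_gt0.
  (* The chain is x^c <= l^c <= l^m <= 2^(m log l), using l >= 1 and [c <= m]. *)
  have xcl : x `^ c <= (2 ^ (m * up_log 2 l))%:R.
    apply: (@le_trans _ _ (l%:R `^ c)).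
      by apply: ge0_ler_powR => //; rewrite ?nnegrE // ltW.
    apply: (@le_trans _ _ (l%:R `^ m%:R)); first exact: ler_powR.
    rewrite powR_mulrn // -natrX ler_nat mulnC expnM.
    by case: (m) => // m'; rewrite leq_exp2r // up_logP.
  rewrite ler_pdivlMr // mulrAC ler_pdivrMr ?ltr0n //.
  apply: (@le_trans _ _ n%:R); last by rewrite ler_peMl //; lra.
  apply: le_trans (_ : (#|unrouted pi P| * 2 ^ (m * up_log 2 l))%N%:R <= _).
    by rewrite natrM ler_wpM2l.
  by rewrite ler_nat.
move=> v; apply: (@le_trans _ _ (C2 * x `^ (c + 1))); last first.
  by rewrite ler_wpM2r ?powR_ge0 //; lra.
have lam : (up_log 2 l)%:R <= b * (a `^ c * x `^ c).
  apply: le_trans (up_log_le_powR l0 c0) _; rewrite ler_wpM2l // -powRM ?(ltW x0) //.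
  by apply: ge0_ler_powR; rewrite ?(ltW c0) ?nnegrE // mulr_ge0 // ltW.
have L1 : (36 * (10 * l).+1)%N%:R <= 396 * (a * x).
  by rewrite natrM -[(10 * l).+1%:R]natr1 natrM; lra.
rewrite powRD; last by rewrite (gt_eqF x0) implybT.
rewrite powRr1 ?(ltW x0) //.
apply: (@le_trans _ _ ((m * up_log 2 l)%N%:R * (36 * (10 * l).+1)%N%:R)).
  by rewrite -natrM ler_nat.
apply: (@le_trans _ _ ((m%:R * (b * (a `^ c * x `^ c))) * (396 * (a * x)))).
  by rewrite ler_pM // natrM ler_wpM2l.
by rewrite le_eqVlt; apply/orP; left; apply/eqP; rewrite /C2; ring.
Qed.
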